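(* Let $\{A_n\}_{n\ge 1}$ be an i.i.d. sequence of random variables with values in $(0,\infty)$, let $a=\inf(\mathrm{supp}(A_1))$ and $b=\sup(\mathrm{supp}(A_1))\in(0,\infty]$, and let $T_n=A_1^{A_2^{\cdots^{A_n}}}$. If any of the following holds, then $T_n$ converges almost surely: 1. $a=0$; 2. $b\in[e^{-e},e^{1/e}]$; 3. $a<1\le b$; 4. $b<e^{-e}$ and $$a<\exp\left(W\left(\frac{1}{\ln b}\right)\exp\left(-\frac{1}{W\left(\frac{1}{\ln b}\right)}\right)\right);$$ 5. $a=1$, $b$ is finite, and $$\liminf_{t\to 1^+}\left[P(A_1\le t)\,\log^\star\left(\frac{1}{t-1}\right)\right]>1.$$
   Context: The power tower is evaluated from the top down: $T_1=A_1$, $T_2=A_1^{A_2}$, $T_3=A_1^{(A_2^{A_3})}$, etc. ''Converges'' means converges to a finite real limit. $W$ is the principal real branch of the Lambert $W$ function, i.e. the inverse of $w\mapsto we^w$ on $[-1,\infty)$, with domain $[-1/e,\infty)$. For $n\ge 0$, $e\star n$ denotes the tower of height $n$: $e\star 0=1$, $e\star(n+1)=e^{e\star n}$. The iterated logarithm is $\log^\star(x)=\inf\{n\in\mathbb{N}: e\star n\ge x\}$. *)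

(* Defs.v *)
From mathcomp Require Import all_boot all_order all_algebra finmap.
From mathcomp Require Import all_classical all_reals all_analysis.

Set Implicit Arguments.
Unset Strict Implicit.
Unset Printing Implicit Defensive.

Import Order.TTheory GRing.Theory Num.Theory.
Import numFieldNormedType.Exports.

Local Open Scope classical_set_scope.
Local Open Scope ring_scope.

(* u 0 `^ (u 1 `^ (... `^ u n.-1)); the empty tower is 1, so that the tower of
   height 1 is u 0. A family (A_n)_{n >= 1} is represented by A : nat -> _ with
   A n standing for A_{n+1}. *)
Fixpoint power_tower (R : realType) (u : nat -> R) (n : nat) : R :=
  if n is m.+1 then u 0 `^ power_tower (fun k => u k.+1) m else 1.

Definition exp_tower (R : realType) (n : nat) : R := iter n expR 1.

Definition log_star (R : realType) (x : R) : R :=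
  inf [set n%:R | n in [set n : nat | x <= exp_tower R n]].

(* Meaningful for x >= - expR (- 1) only: w |-> w * expR w is a bijection from
   [-1, +oo[ onto [- expR (- 1), +oo[; for smaller x the value is arbitrary. *)
Definition lambertW (R : realType) (x : R) : R :=
  [get w : R | -1 <= w /\ w * expR w = x].

Section probability.
Context (d : measure_display) (T : measurableType d) (R : realType).
Context (P : probability T R).
Local Open Scope ereal_scope.

Definition independent (X : nat -> {RV P >-> R}) : Prop :=
  forall (J : {fset nat}) (B : nat -> set R),
    (forall j, measurable (B j)) ->
    P (\bigcap_(j in [set` J]) X j @^-1` B j) =
    \prod_(j <- J) P (X j @^-1` B j).

Definition identically_distributed (X : nat -> {RV P >-> R}) : Prop :=
  forall (m n : nat) (B : set R), measurable B ->
    distribution P (X m) B = distribution P (X n) B.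

Definition iid (X : nat -> {RV P >-> R}) : Prop :=
  independent X /\ identically_distributed X.

Definition law_support (X : {RV P >-> R}) : set R :=
  [set x | forall U : set R, open U -> U x -> 0 < distribution P X U].

Definition inf_support (X : {RV P >-> R}) : \bar R :=
  ereal_inf (EFin @` law_support X).

Definition sup_support (X : {RV P >-> R}) : \bar R :=
  ereal_sup (EFin @` law_support X).

End probability.

(* Main.v *)
Require Import Defs.
From mathcomp Require Import all_boot all_order all_algebra finmap.
From mathcomp Require Import all_classical all_reals all_analysis.
From mathcomp Require Import measurable_realfun ring lra.

Set Implicit Arguments.
Unset Strict Implicit.
Unset Printing Implicit Defensive.

Import Order.TTheory GRing.Theory Num.Theory.
Import numFieldNormedType.Exports.

Local Open Scope classical_set_scope.
Local Open Scope ring_scope.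

(** Write T_n for the tower of height n. If a bounded T_n has no limit, then it
    is infinitely often below and infinitely often above every c of some
    interval: c is crossed. Since T_n is the base u_0 raised to the tower of
    the remaining bases, a value c crossed by the tower of u_0, u_1, ... is
    pulled back to the value ln c / ln u_0, which is crossed by the tower of
    u_1, u_2, ... ([crossed_step]). So a crossed c has an infinite orbit of
    pullbacks, all in the range of possible tower values: in ]0, +oo[, and in
    ]0, 1[ when no base exceeds 1. It therefore suffices that, for each fixed
    (rational) c, the orbit of pullbacks almost surely leaves that range.

    The orbit of c is a Markov chain driven by the bases, and there is a simple
    reason for it to die out ([survival_negligible]): suppose that two patterns
    of m consecutive bases, both of positive probability, send the whole range
    into two disjoint sets. Wherever the orbit stands, it is outside one of
    these sets, and the corresponding pattern in the next m bases kills it. The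
    next bases are independent of the past, so each block of m bases kills the
    orbit with a conditional probability bounded below.

    With bases on both sides of 1, m = 1 is enough: a base below 1 sends
    ]0, +oo[ below 1 and a base above 1 sends it above 1. If all bases are at
    most 1, alternate a base at least be (close to b) with a base at most al
    (close to a). Iterating q |-> be^(al^q) from 0 gives lower bounds l_k on the
    values of the tower after the pattern be, al, be, al, ..., and putting one
    more base at most al in front gives the upper bound al^(l_k). The two ranges
    are disjoint as soon as al^(l_k) <= l_k, which happens for some k unless
    q |-> be^(al^q) has a fixed point q <= al^q ([lower_crossing]). For a = 0
    and for b = 1 a good choice of al and be gives k = 1. For e^-e < b < 1 the
    absence of such a fixed point comes from Euler's result on towers with a
    constant base; for b <= e^-e, the threshold with the Lambert function is the
    minimum over q in ]0, 1/e] of the value of ln a for which q is fixed. Both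
    rest on the inequality 1 - k s <= exp(-k (e^s - 1)) ([expR_exp_ge]), the
    first one on its strict form for k = 1 ([expR_exp_gt]). The degenerate law
    a = b in [e^-e, 1[ is treated directly: a crossed value must then be the
    fixed point of q |-> b^q, which leaves no interval of them.

    If all bases are at least 1, then T_n is nondecreasing and only boundedness
    is at stake. It is clear for bases at most e^(1/e). When a = 1, read a tower
    from its top: its value is controlled by an exponential tower whose height
    grows by 1 at each base, but a base at most 1 + 1/E, where E is the current
    bound, resets the value to at most e, as (1 + 1/E)^E <= e. To have height j
    once all bases are read, the first j bases must exceed j given thresholds,
    an event of probability s_j = (1 - p_c) ... (1 - p_(c+j-1)), where p_m is
    the probability of a base at most 1 + 1/(e*m), for e*m the exponential tower
    of height m. The hypothesis on the limit inferior says that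
    p_m >= (1 + delta) / m for some delta > 0. Hence s_j is summable
    ([kummer_bound]), and the Borel-Cantelli lemma bounds the heights almost
    surely. *)

(** * Towers, crossed values and their pullbacks *)

Definition shift1 (R : Type) (u : nat -> R) : nat -> R := fun k => u k.+1.

Definition crossed (R : realType) (s : nat -> R) (c : R) : Prop :=
  (forall N, exists2 n, (N <= n)%N & s n < c) /\
  (forall N, exists2 n, (N <= n)%N & c < s n).

(** All c strictly between the limits inferior and superior are crossed. A whole
    interval is needed: it contains a rational, and more than one point. *)
Lemma not_cvgn_crossed (R : realType) (s : nat -> R) (M : R) :
  (forall n, 0 <= s n <= M) -> ~ cvgn s ->
  exists x y, x < y /\ forall c, x < c < y -> crossed s c.
Proof.
move=> sM ncv; apply: contra_notP ncv => nosc.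
pose S := [set x : R | forall N, exists2 n, (N <= n)%N & x < s n].
have hS : has_sup S.
  split.
    by exists (-1) => N; exists N => //; have /andP[] := sM N; lra.
  exists M => x /(_ 0%N)[n _ xn]; have /andP[_] := sM n; lra.
apply/cvg_ex; exists (sup S); apply/cvgrPdist_le => e e0.
have up : exists N, forall n, (N <= n)%N -> s n <= sup S + e.
  apply: contrapT => h; have : S (sup S + e).
    move=> N; apply: contrapT => h'; apply: h; exists N => n Nn.
    by rewrite leNgt; apply/negP => sn; apply: h'; exists n.
  by move=> /(ub_le_sup hS.2); lra.
have dn : exists N, forall n, (N <= n)%N -> sup S - e <= s n.
  apply: contrapT => h; apply: nosc; exists (sup S - e), (sup S).
  split; first lra.
  move=> c /andP[ec cS]; split=> N.
    apply: contrapT => h'; apply: h; exists N => n Nn.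
    rewrite leNgt; apply/negP => sn; apply: h'; exists n => //; lra.
  have [x Sx cx] : exists2 x, S x & c < x.
    have c0 : 0 < sup S - c by lra.
    by have [x Sx] := sup_adherent c0 hS; exists x => //; lra.
  by have [n Nn xn] := Sx N; exists n => //; lra.
have [N1 h1] := up; have [N2 h2] := dn.
exists (maxn N1 N2) => // n /=; rewrite geq_max => /andP[n1 n2].
have := h1 _ n1; have := h2 _ n2; rewrite ler_norml; lra.
Qed.

(** The orbit of c under the inverses of y |-> (u_k)^y. As x / 0 = 0, a base
    equal to 1 sends the orbit to 0, out of the range of tower values. *)
Fixpoint pullback (R : realType) (c : R) (u : nat -> R) (n : nat) : R :=
  if n is m.+1 then ln (pullback c u m) / ln (u m) else c.

Lemma pullback_add (R : realType) (c : R) (u : nat -> R) (n m : nat) :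
  pullback c u (n + m) = pullback (pullback c u n) (fun k => u (n + k)%N) m.
Proof. by elim: m => [|m IH]; rewrite ?addn0// addnS /= IH. Qed.

Lemma pullbackS (R : realType) (c : R) (u : nat -> R) (m : nat) :
  pullback c u m.+1 = pullback (ln c / ln (u 0%N)) (shift1 u) m.
Proof. by rewrite -add1n pullback_add. Qed.

Section tower.
Context (R : realType).
Implicit Types (u : nat -> R) (c t x : R).

Lemma powR_le1 x t : 0 < x <= 1 -> 0 <= t -> x `^ t <= 1.
Proof.
move=> /andP[x0 x1] t0; have /= <- := congr1 (fun f => f t) (@powR1 R).
by rewrite ge0_ler_powR ?nnegrE// ltW.
Qed.

Lemma power_towerS u n :
  power_tower u n.+1 = u 0%N `^ power_tower (shift1 u) n.
Proof. by []. Qed.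

Lemma power_tower_gt0 u n : (forall k, 0 < u k) -> 0 < power_tower u n.
Proof. by case: n => [|n] u0 //=; rewrite powR_gt0. Qed.

(** A base at most 1 caps everything above it at 1; the finitely many
    bases below it then map [0, 1] to a bounded set. *)
Lemma power_tower_bounded u k : (forall k, 0 < u k) -> u k <= 1 ->
  exists M, forall n, power_tower u n <= M.
Proof.
elim: k u => [|k IH] u u0 uk.
  exists 1 => -[|n] //=; rewrite powR_le1 ?u0//.
  by rewrite ltW// power_tower_gt0// => n'; exact: u0.
have [//|M hM] := IH (shift1 u) (fun k => u0 _).
exists (Num.max 1 (Num.max 1 (u 0%N) `^ M)) => -[|n].
  by rewrite /= le_max lexx.
rewrite power_towerS le_max; apply/orP; right.
apply: (@le_trans _ _ (Num.max 1 (u 0%N) `^ power_tower (shift1 u) n)).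
  rewrite ge0_ler_powR ?nnegrE// ?le_max ?lexx ?orbT ?ltW//.
  by rewrite power_tower_gt0// => n'; exact: u0.
by rewrite ler_powR // le_max lexx.
Qed.

(** The map y |-> (u_0)^y is strictly monotone for u_0 <> 1, so it carries the
    crossed values of the remaining tower to those of the tower, exchanging
    above and below if u_0 < 1; for u_0 = 1 the tower is eventually constant. *)
Lemma crossed_step u c : (forall k, 0 < u k) -> crossed (power_tower u) c ->
  [/\ 0 < c, u 0%N != 1 & crossed (power_tower (shift1 u)) (ln c / ln (u 0%N))].
Proof.
move=> u0 [lo hi].
have us0 k : 0 < shift1 u k by exact: u0.
have c0 : 0 < c.
  by have [n _ h] := lo 0%N; apply: lt_trans h; exact: power_tower_gt0.
have un1 : u 0%N != 1.
  apply/eqP => u1; have [[|n] // _] := lo 1%N; have [[|m] // _] := hi 1%N.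
  by rewrite !power_towerS u1 !powR1; lra.
have E n : ln (power_tower u n.+1) = power_tower (shift1 u) n * ln (u 0%N).
  by rewrite power_towerS ln_powR.
have lo' N : exists2 n, (N <= n)%N &
    power_tower (shift1 u) n * ln (u 0%N) < ln c.
  have [[|n]// Nn h] := lo N.+1; exists n => //.
  by rewrite -E ltr_ln// posrE power_tower_gt0.
have hi' N : exists2 n, (N <= n)%N &
    ln c < power_tower (shift1 u) n * ln (u 0%N).
  have [[|n]// Nn h] := hi N.+1; exists n => //.
  by rewrite -E ltr_ln// posrE power_tower_gt0.
split=> //; have [l0|l0|/eqP] := ltgtP (ln (u 0%N)) 0; last first.
- by rewrite ln_eq0 ?u0// (negPf un1).
- split=> N.
    by have [n Nn h] := lo' N; exists n => //; rewrite ltr_pdivlMr.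
  by have [n Nn h] := hi' N; exists n => //; rewrite ltr_pdivrMr.
- split=> N.
    by have [n Nn h] := hi' N; exists n => //; rewrite ltr_ndivlMr.
  by have [n Nn h] := lo' N; exists n => //; rewrite ltr_ndivrMr.
Qed.

Lemma crossed_pullback u c n : (forall k, 0 < u k) ->
  crossed (power_tower u) c ->
  crossed (power_tower (fun k => u (n + k)%N)) (pullback c u n).
Proof.
move=> u0 uc; elim: n => [//|n IH].
have [_ _] := crossed_step (fun k => u0 (n + k)%N) IH.
rewrite /= addn0; congr crossed; apply/funext => m; congr power_tower.
by apply/funext => k; rewrite /shift1 addnS.
Qed.

Lemma crossed_pullback_gt0 u c n : (forall k, 0 < u k) ->
  crossed (power_tower u) c -> 0 < pullback c u n.
Proof.
move=> u0 /(crossed_pullback n u0) /crossed_step[]// k; exact: u0.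
Qed.

Lemma crossed_pullback_lt1 u c n : (forall k, 0 < u k <= 1) ->
  crossed (power_tower u) c -> pullback c u n < 1.
Proof.
move=> u01 uc; have u0 k : 0 < u k by have /andP[] := u01 k.
have [_ /(_ 0%N)[[|m] _]] := crossed_pullback n u0 uc; first by [].
move=> /lt_le_trans; apply; rewrite power_towerS.
by rewrite powR_le1 ?u01// ltW// power_tower_gt0// => k; exact: u0.
Qed.

Lemma power_tower_ge1 u n : (forall k, 1 <= u k) -> 1 <= power_tower u n.
Proof.
move=> u1; case: n => [//|n]; rewrite power_towerS.
rewrite -[leLHS](@powRr0 R (u 0%N)) ler_powR//.
by rewrite ltW// power_tower_gt0// => k; rewrite (lt_le_trans _ (u1 _)).
Qed.

Lemma power_tower_nondecreasing u : (forall k, 1 <= u k) ->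
  nondecreasing_seq (power_tower u).
Proof.
move=> u1; apply/nondecreasing_seqP => n.
elim: n u u1 => [|n IH] u u1; first exact: power_tower_ge1.
by rewrite 2!power_towerS ler_powR// IH// => k; exact: u1.
Qed.

Lemma power_tower_ge1_cvg u M : (forall k, 1 <= u k) ->
  (forall n, power_tower u n <= M) -> cvgn (power_tower u).
Proof.
move=> u1 uM; apply: nondecreasing_is_cvgn.
  exact: power_tower_nondecreasing.
by exists M => _ [n _ <-]; exact: uM.
Qed.

(** The interval [1, e] is stable under y |-> x^y, because x^e <= e. *)
Lemma power_tower_le_e u n : (forall k, 1 <= u k <= expR (1 / expR 1)) ->
  power_tower u n <= expR 1.
Proof.
elim: n u => [|n IH] u u1.
  by rewrite /= -[leLHS]expR0 ler_expR.
have /andP[l1 le] := u1 0%N.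
rewrite power_towerS /powR gt_eqF; last lra.
rewrite ler_expR -(@divff _ (expR 1 : R)) ?gt_eqF ?expR_gt0//.
rewrite ler_pM ?ln_ge0//.
- rewrite ltW// power_tower_gt0// => k; have /andP[] := u1 k.+1.
  by move=> h _; rewrite (lt_le_trans _ h).
- by apply: IH => k; exact: u1.
- rewrite -[leRHS]expRK -div1r ler_ln ?posrE ?expR_gt0//; lra.
Qed.

End tower.

(** * Independence of later bases from the past *)

Section independence.
Context (R : realType) (d : measure_display) (T : measurableType d).
Context (P : probability T R) (A : nat -> {RV P >-> R}).
Context (A_iid : iid A).
Local Open Scope ereal_scope.

Definition block (n m : nat) (B : nat -> set R) : set T :=
  \bigcap_(j in `I_m) A (n + j)%N @^-1` B j.

Lemma measurable_preimage n (B : set R) :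
  measurable B -> measurable (A n @^-1` B).
Proof.
by move=> mB; rewrite -[X in measurable X]setTI; exact: measurable_funP.
Qed.

Lemma measurable_block n m B : (forall j, measurable (B j)) ->
  measurable (block n m B).
Proof.
move=> mB; rewrite /block bigcap_mkcond; apply: bigcap_measurable => //.
by move=> k _; case: ifP => // _; exact: measurable_preimage.
Qed.

Lemma preimage_iid n (B : set R) : measurable B ->
  P (A n @^-1` B) = P (A 0%N @^-1` B).
Proof. by move=> mB; have := A_iid.2 n 0%N B mB. Qed.

Lemma prob_block0 m B : (forall j, measurable (B j)) ->
  P (block 0 m B) = \prod_(0 <= j < m) P (A 0%N @^-1` B j).
Proof.
move=> mB; have [ind idt] := A_iid.
pose J := [fset x in iota 0 m]%fset.
have JE j : (j \in J) = (j < m)%N by rewrite !inE /= mem_iota.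
have -> : block 0 m B = \bigcap_(j in [set` J]) A j @^-1` B j.
  by apply: eq_bigcapl; split=> j /=; rewrite JE.
rewrite ind// (perm_big (iota 0 m)) /=; last first.
  apply: uniq_perm; rewrite ?fset_uniq ?iota_uniq// => j.
  by rewrite JE mem_iota.
rewrite /index_iota subn0; apply: eq_bigr => j _; exact: preimage_iid.
Qed.

Lemma block_cat n m (C B : nat -> set R) :
  block 0 n C `&` block n m B =
  block 0 (n + m) (fun j => if (j < n)%N then C j else B (j - n)%N).
Proof.
apply/seteqP; split => w /=.
  move=> [h1 h2] j /= jnm; case: ltnP => jn; first exact: h1.
  have := h2 (j - n)%N; rewrite /= !add0n subnKC//; apply.
  by rewrite ltn_subLR.
move=> h; split=> j /= jn.
  by have := h j; rewrite /= jn; apply; rewrite ltn_addr.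
have := h (n + j)%N; rewrite /= ltn_add2l jn ltnNge leq_addr /= addKn.
exact.
Qed.

Lemma prob_block n m B : (forall j, measurable (B j)) ->
  P (block n m B) = \prod_(0 <= j < m) P (A 0%N @^-1` B j).
Proof.
move=> mB; have := block_cat n m (fun=> setT) B.
have -> : block 0 n (fun=> setT) = setT by apply/seteqP.
rewrite setTI => ->; rewrite prob_block0; last by move=> j; case: ifP.
rewrite (@big_cat_nat _ _ _ n) ?leq_addr//= big_nat big1 ?mul1e; last first.
  by move=> j /andP[_ ->]; rewrite preimage_setT probability_setT.
rewrite -{1}[n]add0n big_addn addKn; apply: eq_bigr => j _.
by rewrite ltnNge leq_addl/= addnK.
Qed.

Lemma prob_block_cat n m C B :
  (forall j, measurable (B j)) -> (forall j, measurable (C j)) ->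
  P (block 0 n C `&` block n m B) = P (block 0 n C) * P (block n m B).
Proof.
move=> mB mC.
rewrite block_cat (prob_block _ _ mB) (prob_block _ _ mC) prob_block;
  last first.
  by move=> j; case: ifP.
rewrite (@big_cat_nat _ _ _ n) ?leq_addr//=; congr (_ * _).
  by rewrite big_nat [RHS]big_nat; apply: eq_bigr => j /andP[_ ->].
rewrite -{1}[n]add0n big_addn addKn; apply: eq_bigr => j _.
by rewrite ltnNge leq_addl/= addnK.
Qed.

(** The cylinders on the first n variables: a generator, stable under
    intersection, of the sigma-algebra that they span. *)
Definition past (n : nat) : set (set T) :=
  [set E | exists2 C, forall j, measurable (C j) & E = block 0 n C].

Lemma past_setI n : setI_closed (past n).
Proof.
move=> _ _ [C mC ->] [D mD ->]; exists (fun j => C j `&` D j).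
  by move=> j; exact: measurableI.
by rewrite /block -bigcapI.
Qed.

Lemma past_measurable n E : <<s past n >> E -> measurable E.
Proof.
move: E; apply: smallest_sub; first exact: sigma_algebra_measurable.
by move=> _ [C mC ->]; exact: measurable_block.
Qed.

(** Independence of cylinders extends from the generating pi-system to the
    sigma-algebra by Dynkin's theorem. *)
Lemma past_independent n m B E : (forall j, measurable (B j)) ->
  <<s past n >> E -> P (E `&` block n m B) = P E * P (block n m B).
Proof.
move=> mB; set F := block n m B.
have mF : measurable F by exact: measurable_block.
suff: <<s past n >> `<=` [set E | measurable E /\ P (E `&` F) = P E * P F].
  by move=> h /h [].
rewrite -setI_closed_g_dynkin_g_sigma_algebra; last exact: past_setI.
apply: smallest_sub => [|_ [C mC ->]]; last first.
  by split; [exact: measurable_block|exact: prob_block_cat].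
split.
- by rewrite /= setTI probability_setT mul1e.
- move=> X [mX XF]; split; first exact: measurableC.
  have fF : P F \is a fin_num by exact: fin_num_measure.
  rewrite probability_setC// muleBl ?fin_num_measure//.
  rewrite -XF mul1e setIC -setDE measureD//; first by rewrite setIC.
  by rewrite ltey_eq fF.
- move=> X tX mX; split.
    by apply: bigcup_measurable => k _; have [] := mX k.
  rewrite setI_bigcupl !measure_bigcup//=; last 3 first.
  + by move=> k _; have [] := mX k.
  + by move=> k _; apply: measurableI => //; have [] := mX k.
  + exact: trivIset_setIr.
  have fF : P F \is a fin_num by exact: fin_num_measure.
  rewrite muleC -(fineK fF) -nneseriesZl; last by move=> *.
  by apply: eq_eseriesr => k _; rewrite fineK// muleC; have [] := mX k.
Qed.

End independence.

(** * Extinction of the orbit of pullbacks *)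

Lemma measurable_inv (R : realType) : measurable_fun [set: R] (@GRing.inv R).
Proof.
have -> : @GRing.inv R = fun x => x * (x ^+ 2) `^ (-1).
  apply/funext => x; rewrite powR_inv1 ?sqr_ge0//.
  have [->|x0] := eqVneq x 0; first by rewrite invr0 mul0r.
  by rewrite expr2 invfM mulrA divff// mul1r.
apply: measurable_funM => //.
apply: (measurableT_comp (measurable_powR _)); exact: measurable_funX.
Qed.

Section survival.
Context (R : realType) (d : measure_display) (T : measurableType d).
Context (P : probability T R) (A : nat -> {RV P >-> R}).
Context (A_iid : iid A).

Lemma sub_past k n : (k <= n)%N -> past A k `<=` past A n.
Proof.
move=> kn _ [C mC ->]; exists (fun j => if (j < k)%N then C j else setT).
  by move=> j; case: ifP.
apply/seteqP; split => w h j /= jn; first by case: ifP => // jk; exact: h.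
by have := h j; rewrite /= jn; apply; exact: leq_trans kn.
Qed.

Lemma past_measurable_fun j n : (j < n)%N ->
  measurable_fun [set: g_sigma_algebraType (past A n)] (A j).
Proof.
move=> jn _ Y mY; rewrite setTI; apply: sub_sigma_algebra.
exists (fun i => if i == j then Y else setT).
  by move=> i; case: ifP.
apply/seteqP; split => w /=; first by move=> h i /= _; case: eqP => // ->.
by move=> /(_ j jn); rewrite eqxx.
Qed.

(** The k-th pullback depends on the first k bases only; this is what makes the
    next block of bases independent of it. *)
Lemma pullback_past_measurable c k n : (k <= n)%N ->
  measurable_fun [set: g_sigma_algebraType (past A n)]
    (fun w => pullback c (A^~ w) k).
Proof.
elim: k => [|k IH] kn /=; first exact: measurable_cst.
apply: measurable_funM.
  by apply: measurableT_comp; [exact: measurable_ln|exact: IH (ltnW kn)].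
apply: (measurableT_comp (@measurable_inv R)).
by apply: measurableT_comp; [exact: measurable_ln|exact: past_measurable_fun].
Qed.

Lemma past_pullback c k n (J : set R) : (k <= n)%N -> measurable J ->
  <<s past A n >> [set w | J (pullback c (A^~ w) k)].
Proof.
move=> kn mJ; rewrite -[X in <<s _ >> X]setTI.
exact: (@pullback_past_measurable c k n kn measurableT J mJ).
Qed.

Lemma past_survive c n (I : set R) : measurable I ->
  <<s past A n >> [set w | forall k, (k <= n)%N -> I (pullback c (A^~ w) k)].
Proof.
move=> mI; rewrite (_ : [set _ | _] = \bigcap_(k in `I_n.+1)
    [set w | I (pullback c (A^~ w) k)]); last by apply/seteqP; split.
rewrite bigcap_mkcond.
apply: (@bigcap_measurable _ (g_sigma_algebraType (past A n))) => // k _.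
case: ifP => [|_]; last exact: measurableT.
by rewrite inE /= ltnS => kn; exact: past_pullback.
Qed.

Local Open Scope ereal_scope.

Lemma past_independentD n m B E : (forall j, measurable (B j)) ->
  <<s past A n >> E ->
  P (E `\` block A n m B) = P E * (1 - P (block A n m B)).
Proof.
move=> mB pE; have mE := past_measurable pE.
have mF : measurable (block A n m B) by exact: measurable_block.
rewrite measureD//; last by rewrite ltey_eq fin_num_measure.
rewrite [X in _ - X](past_independent A_iid m mB pE) muleBr ?fin_num_measure//.
by rewrite mule1.
Qed.

Lemma negligible_geometric (E : nat -> set T) (r : R) : (0 <= r < 1)%R ->
  (forall n, measurable (E n)) -> (forall n, P (E n) <= (r ^+ n)%:E) ->
  P.-negligible (\bigcap_n E n).
Proof.
move=> /andP[r0 r1] mE PE; have mcap : measurable (\bigcap_n E n).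
  by apply: bigcap_measurable => //; exists 0%N.
apply/negligibleP => //; apply/eqP; rewrite eq_le measure_ge0 andbT.
apply/lee_addgt0Pr => eps eps0; rewrite add0e.
have /cvgrPdist_lt/(_ _ eps0)[N _ /(_ N (leqnn N))] :
    (fun n => r ^+ n)%R @ \oo --> (0 : R)%R.
  by apply: cvg_expr; rewrite ger0_norm.
rewrite /= sub0r normrN ger0_norm ?exprn_ge0// => rN.
apply: (@le_trans _ _ (P (E N))).
  by rewrite le_measure ?inE// => w; apply.
by apply: (le_trans (PE N)); rewrite lee_fin ltW.
Qed.

(** The first n variables all miss B with probability (1 - P(B))^n. *)
Lemma ae_hit (B : set R) : measurable B -> 0 < P (A 0%N @^-1` B) ->
  {ae P, forall w, exists k, B (A k w)}.
Proof.
move=> mB pB; have mC : measurable (~` B) by exact: measurableC.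
pose r := fine (P (A 0%N @^-1` ~` B)).
have rE : P (A 0%N @^-1` ~` B) = r%:E.
  by rewrite fineK// fin_num_measure//; exact: (measurable_preimage A 0 mC).
have r0 : (0 <= r)%R by rewrite -lee_fin -rE.
have r1 : (r < 1)%R.
  rewrite -lte_fin -rE -preimage_setC probability_setC; last first.
    exact: (measurable_preimage A 0 mB).
  rewrite lteBlDr ?fin_num_measure//; last exact: (measurable_preimage A 0 mB).
  by rewrite -[ltLHS]adde0 lteD2lE.
have PE n : P (block A 0 n (fun=> ~` B)) <= (r ^+ n)%:E.
  rewrite (prob_block A_iid)//; elim: n => [|n IH]; first by rewrite big_geq.
  rewrite big_nat_recr//= exprSr EFinM -rE.
  exact: lee_wpmul2r.
apply: (@negligibleS _ _ _ P (\bigcap_n block A 0 n (fun=> ~` B))).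
  by move=> w /= /forallNP h n _ k _; exact: h.
apply: (@negligible_geometric _ r); first by rewrite r0.
  by move=> n; exact: measurable_block.
exact: PE.
Qed.

Lemma ae_all (B : set R) : measurable B -> P (A 0%N @^-1` ~` B) = 0 ->
  {ae P, forall w, forall k, B (A k w)}.
Proof.
move=> mB pB; apply: ae_foralln => n.
exists (A n @^-1` ~` B); split => //.
  by apply: (measurable_preimage A); exact: measurableC.
by rewrite -pB; apply: (preimage_iid A_iid); exact: measurableC.
Qed.

(** A surviving block of m pullbacks whose bases follow the pattern B1 must have
    started in J, and one whose bases follow B2 must have started outside J. So,
    whatever the current point of the orbit, one of the two patterns kills it,
    and the probability of surviving n blocks is at most (1 - e)^n, where e is
    the smaller of the probabilities of the patterns. *)
Lemma survival_negligible m (B1 B2 : nat -> set R) (I J : set R) (c : R) :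
  (forall j, measurable (B1 j)) -> (forall j, measurable (B2 j)) ->
  measurable I -> measurable J ->
  (forall j, 0 < P (A 0%N @^-1` B1 j)) ->
  (forall j, 0 < P (A 0%N @^-1` B2 j)) ->
  (forall u x, (forall i, (i < m)%N -> B1 i (u i)) ->
    (forall k, (k <= m)%N -> I (pullback x u k)) -> J x) ->
  (forall u x, (forall i, (i < m)%N -> B2 i (u i)) ->
    (forall k, (k <= m)%N -> I (pullback x u k)) -> ~ J x) ->
  P.-negligible [set w | forall k, I (pullback c (A^~ w) k)].
Proof.
move=> mB1 mB2 mI mJ p1 p2 h1 h2.
have prod_gt0 B : (forall j, 0 < P (A 0%N @^-1` B j)) ->
    0 < \prod_(0 <= j < m) P (A 0%N @^-1` B j).
  by move=> hB; apply: (big_ind (fun x => 0 < x)) => // x y; exact: mule_gt0.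
pose p B := \prod_(0 <= j < m) P (A 0%N @^-1` B j).
have pE n B : (forall j, measurable (B j)) -> P (block A n m B) = p B.
  by move=> mB; exact: (prob_block A_iid).
pose e := Order.min (p B1) (p B2).
have e0 : 0 < e by rewrite lt_min !prod_gt0.
have e1 : e <= 1.
  rewrite ge_min -(pE 0%N B1)//; apply/orP; left.
  by apply: probability_le1; exact: measurable_block.
have fe : e \is a fin_num.
  by rewrite ge0_fin_numE ?ltW// (le_lt_trans e1)// ltey.
pose E n := [set w | forall k, (k <= n * m)%N -> I (pullback c (A^~ w) k)].
have pastE n : <<s past A (n * m) >> (E n) by exact: past_survive.
have mE n : measurable (E n) by exact: past_measurable (pastE n).
have step n : P (E n.+1) <= P (E n) * (1 - e).
  pose K := [set w | J (pullback c (A^~ w) (n * m))].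
  have pK : <<s past A (n * m) >> K by exact: past_pullback.
  have pX : <<s past A (n * m) >> (E n `&` K).
    exact: (@measurableI _ (g_sigma_algebraType (past A (n * m)))
      _ _ (pastE n) pK).
  have pY : <<s past A (n * m) >> (E n `\` K).
    exact: (@measurableD _ (g_sigma_algebraType (past A (n * m)))
      _ _ (pastE n) pK).
  have mK := past_measurable pK.
  have mX := past_measurable pX; have mY := past_measurable pY.
  pose F1 := block A (n * m) m B1; pose F2 := block A (n * m) m B2.
  have mF1 : measurable F1 by exact: measurable_block.
  have mF2 : measurable F2 by exact: measurable_block.
  (* The current point is in J or not, and only one of the two patterns is
     compatible with survival accordingly. *)
  have sub : E n.+1 `<=` ((E n `&` K) `\` F2) `|` ((E n `\` K) `\` F1).
    move=> w Ew; have Enw : E n w.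
      by move=> k kn; apply: Ew; rewrite (leq_trans kn)// leq_mul2r leqnSn orbT.
    pose u := fun k => A (n * m + k)%N w.
    have Eu k : (k <= m)%N -> I (pullback (pullback c (A^~ w) (n * m)) u k).
      by move=> km; rewrite -pullback_add; apply: Ew; rewrite mulSnr leq_add2l.
    have [Kw|Kw] := pselect (K w); [left|right]; split=> // Fw.
      by apply: (h2 u _ _ Eu) => // i im; exact: Fw.
    by apply: Kw; apply: (h1 u _ _ Eu) => // i im; exact: Fw.
  have mD1 : measurable ((E n `&` K) `\` F2) by exact: measurableD.
  have mD2 : measurable ((E n `\` K) `\` F1) by exact: measurableD.
  apply: (@le_trans _ _ (P (((E n `&` K) `\` F2) `|` ((E n `\` K) `\` F1)))).
    by rewrite le_measure ?inE//; exact: measurableU.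
  apply: (@le_trans _ _
      (P ((E n `&` K) `\` F2) + P ((E n `\` K) `\` F1))).
    exact: measureU2.
  have -> : P (E n) = P (E n `&` K) + P (E n `\` K).
    by rewrite addeC; exact: measureDI.
  rewrite !past_independentD// !pE//.
  rewrite ge0_muleDl//; apply: leeD; apply: lee_wpmul2l => //;
    by apply: leeB => //; rewrite ge_min lexx ?orbT.
pose r := (1 - fine e)%R.
have rE : 1 - e = r%:E by rewrite /r EFinB fineK.
have r0 : (0 <= r)%R by rewrite -lee_fin -rE sube_ge0 ?fe.
have r1 : (r < 1)%R.
  rewrite /r gtrBl; apply: fine_gt0; rewrite e0 /=.
  by rewrite (le_lt_trans e1)// ltey.
have PE n : P (E n) <= (r ^+ n)%:E.
  elim: n => [|n IH]; first by rewrite expr0; exact: probability_le1.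
  apply: (le_trans (step n)); rewrite rE exprSr EFinM.
  by apply: lee_wpmul2r => //; rewrite lee_fin.
apply: (@negligibleS _ _ _ P (\bigcap_n E n)).
  by move=> w h n _ k _; exact: h.
by apply: (@negligible_geometric _ r) => //; rewrite r0.
Qed.

End survival.

(** * Inequalities for the two-step map *)

Section inequalities.
Context (R : realType).
Implicit Types (k s q w : R).

Definition exp_gap k s := expR (- k * (expR s - 1)) + k * s.

Lemma exp_gap_MVT k x y : x < y -> exists2 c, x < c < y &
  exp_gap k y - exp_gap k x = k * (1 - expR (c - k * (expR c - 1))) * (y - x).
Proof.
move=> xy.
have dg (c : R) : is_derive c 1 (exp_gap k)
    (k * (1 - expR (c - k * (expR c - 1)))).
  have h1 : is_derive c 1 (fun s : R => - k * (expR s - 1)) (- k * expR c).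
    apply: is_derive_eq; rewrite subr0 -[_ *: _]/(_ * _); ring.
  have h2 := @is_derive1_comp R expR _ c _ _ (is_derive_expR _) h1.
  apply: is_derive_eq; rewrite -![_ *: _]/(_ * _) /= expRD mulNr.
  by rewrite /GRing.scale /=; ring.
have drv c : derivable (exp_gap k) c 1 by case: (dg c).
have cg : {within `[x, y], continuous (exp_gap k)}.
  by apply: derivable_within_continuous => c _; exact: drv.
have [c cxy ->] := MVT xy (fun c _ => dg c) cg.
by exists c => //; move: cxy; rewrite in_itv.
Qed.

(** The difference of the two sides vanishes at s = 0 and is minimal there: its
    derivative has the sign of k (e^s - 1) - s, which is nonnegative for s > 0
    as k >= 1, and nonpositive for s < 0 as long as k e^s >= 1, because then
    k (1 - e^s) >= e^-s - 1 >= - s. *)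
Lemma expR_exp_ge k s : 1 <= k -> 1 <= k * expR s ->
  1 - k * s <= expR (- k * (expR s - 1)).
Proof.
move=> k1 ks; have g0 : exp_gap k 0 = 1.
  by rewrite /exp_gap expR0 subrr !mulr0 expR0 addr0.
suff : exp_gap k 0 <= exp_gap k s by rewrite g0 /exp_gap; lra.
have [s0|s0|->//] := ltgtP s 0.
  have [c /andP[sc c0] E] := exp_gap_MVT k s0; rewrite -subr_le0 E.
  suff : 0 <= c - k * (expR c - 1).
    rewrite -ler_expR expR0 => h.
    by rewrite mulr_le0_ge0 ?mulr_ge0_le0//; lra.
  have kc : 1 <= k * expR c.
    by apply: le_trans ks _; rewrite ler_pM2l ?ler_expR; lra.
  have := expR_ge1Dx (- c); have := expR_gt0 c; have := expR_gt0 (- c).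
  have : expR c * expR (- c) = 1 by rewrite -expRD subrr expR0.
  have : expR c <= 1 by rewrite -expR0 ler_expR ltW.
  nra.
have [c /andP[c0 cs] E] := exp_gap_MVT k s0; rewrite -subr_ge0 E.
have : expR (c - k * (expR c - 1)) <= 1.
  rewrite -[leRHS]expR0 ler_expR; have := expR_ge1Dx c; nra.
by move=> h; rewrite !mulr_ge0//; lra.
Qed.

Lemma expR_exp_gt s : 0 < s -> 1 - s < expR (1 - expR s).
Proof.
move=> s0; have [c /andP[c0 cs]] := exp_gap_MVT 1 s0.
rewrite /exp_gap expR0 subrr !mulr0 expR0 !mul1r mulN1r opprB.
have : expR (c - (expR c - 1)) < 1.
  by rewrite -[ltRHS]expR0 ltr_expR; have := expR_gt1Dx (lt0r_neq0 c0); lra.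
nra.
Qed.

(** Two levels of a tower; for bases below 1 each level is decreasing in q and
    their composition is increasing. *)
Definition two_step (al be q : R) : R := be `^ (al `^ q).

(** With q = exp(- k e^s), the claim q < be^(al^q) reads
    q ln al < s - 1/k, and [expR_exp_ge] gives - q e^k / k <= s - 1/k; the
    condition q <= 1/e is k e^s >= 1. Equality holds at s = 0, so the bound on
    ln al is the best one. In terms of w = - 1/k, one has w e^w = 1 / ln be and
    - e^k / k = w e^(-1/w): this is the threshold with the Lambert function. *)
Lemma two_step_gt_lambert k al be q : 1 <= k -> 0 < al ->
  ln al < - expR k / k -> be = expR (- k * expR (1 / k)) ->
  0 < q <= expR (- 1) -> q < two_step al be q.
Proof.
move=> k1 al0 lal -> /andP[q0 q1].
have k0 : 0 < k by lra.
have lq : ln q <= - 1 by rewrite -[leRHS]expRK ler_ln ?posrE ?expR_gt0.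
pose s := ln (- ln q / k).
have es : k * expR s = - ln q.
  by rewrite lnK ?posrE; [field; lra|apply: divr_gt0; lra].
have K := @expR_exp_ge k s k1; rewrite es in K.
have {K} K : 1 - k * s <= expR (- k * (expR s - 1)) by apply: K; lra.
have qE : expR (- k * (expR s - 1)) = q * expR k.
  rewrite (_ : - k * _ = ln q + k); last first.
    by rewrite mulrBr mulr1 mulNr es; lra.
  by rewrite expRD lnK.
rewrite {}qE in K.
rewrite /two_step /powR !gt_eqF ?expR_gt0// expRK.
rewrite -[ltLHS](lnK (x:=q)) ?posrE// ltr_expR.
have -> : ln q = - (k * expR s) by rewrite es opprK.
rewrite [ltRHS](_ : _ = - (k * expR (q * ln al + 1 / k))); last first.
  by rewrite expRD; ring.
rewrite ltrN2 ltr_pM2l// ltr_expR.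
have h : q * ln al < - (q * expR k / k).
  by rewrite -mulrA -mulrN -mulNr ltr_pM2l.
have : 1 / k - s <= q * expR k / k.
  rewrite ler_pdivlMr//; apply: le_trans K; rewrite le_eqVlt; apply/orP; left.
  by apply/eqP; field; lra.
lra.
Qed.

(** For bases at least e^-e the two-step map has no fixed point below the fixed
    point of q |-> be^q. With v = - ln q and u = - ln (be^q) the hypotheses are
    u < v and u e^v = - ln be <= e, so that u <= e^(1-v) and u < 1. If the claim
    failed, then v e^-v <= u e^-u. As x e^-x increases on [0, 1], this implies
    that v > 1, and then that v e^-v <= y e^-y for y = e^(1-v), that is,
    ln v <= 1 - e^(1-v), against [expR_exp_gt]. *)
Lemma two_step_gt_euler be q : expR (- expR 1) <= be < 1 ->
  0 < q < be `^ q -> q < two_step be be q.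
Proof.
move=> /andP[be_e be1] /andP[q0 qb].
have be0 : 0 < be by rewrite (lt_le_trans _ be_e)// expR_gt0.
pose B := - ln be.
have B0 : 0 < B by rewrite /B oppr_gt0 ln_lt0// be0.
have Be : B <= expR 1.
  by rewrite /B lerNl -[leLHS]expRK ler_ln ?posrE ?expR_gt0.
pose v := - ln q; pose u := B * q.
have qE : q = expR (- v) by rewrite /v opprK lnK.
have powE x : be `^ x = expR (- (B * x)).
  by rewrite /powR gt_eqF// /B mulNr opprK mulrC.
have u0 : 0 < u by exact: mulr_gt0.
have uv : u < v.
  by move: qb; rewrite powE {1}qE ltr_expR ltrN2.
rewrite /two_step !powE -/u {1}qE ltr_expR ltrN2 ltNge; apply/negP => vB.
have uE : u * expR v = B.
  by rewrite /u qE -mulrA -expRD addrC subrr expR0 mulr1.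
have uve : v * expR u <= u * expR v.
  rewrite uE; move: vB; rewrite (expRN u) -ler_pdivlMr ?expR_gt0//.
have lnle : ln v + u <= ln u + v.
  have v0 : 0 < v by lra.
  rewrite -[u in ln v + u]expRK -[v in ln u + v]expRK.
  by rewrite -!lnM ?posrE ?expR_gt0// ler_ln ?posrE ?mulr_gt0 ?expR_gt0.
have lnu : ln u <= 1 - v.
  suff : ln u + v <= 1 by lra.
  rewrite -[v in ln u + v]expRK -lnM ?posrE ?expR_gt0// uE.
  by rewrite -[leRHS]expRK ler_ln ?posrE ?expR_gt0.
have [v1|v1] := leP v 1.
  have := @expR_gt1Dx R (- (v - u)).
  have := expR_ge1Dx (u - v).
  have : expR (v - u) * expR (- (v - u)) = 1 by rewrite -expRD subrr expR0.
  have vu : v <= u * expR (v - u).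
    rewrite expRD (expRN u) mulrA ler_pdivlMr ?expR_gt0//.
  have := expR_gt0 (v - u); have := expR_gt0 (- (v - u)).
  move=> h1 h2 h3 _ /(_ _)/wrap[]; first by apply/eqP; lra.
  nra.
have yE : ln u = ln (u / expR (1 - v)) + (1 - v).
  by rewrite ln_div ?posrE ?expR_gt0// expRK; lra.
pose y := expR (1 - v).
have y0 : 0 < y by exact: expR_gt0.
have y1 : y < 1 by rewrite -[ltRHS]expR0 ltr_expR; lra.
have uy : u <= y by rewrite -(lnK (x:=u)) ?posrE// ler_expR.
have := expR_exp_gt (ln_gt0 v1); rewrite lnK ?posrE; last lra.
rewrite -/y.
have : ln (u / y) <= u / y - 1.
  have := @le_ln1Dx R (u / y - 1); rewrite (addrC 1) subrK; apply.
  by have := divr_gt0 u0 y0; lra.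
have : u / y - 1 <= u - y.
  have -> : u / y - 1 = (u - y) / y by field; lra.
  rewrite ler_pdivrMr//; nra.
move: yE; rewrite -/y; lra.
Qed.

(** This makes the parametrization be = exp(- k e^(1/k)), k >= 1, of the bases
    at most e^-e strictly decreasing in k. *)
Lemma mulr_expRV_lt k k' : 1 <= k -> k < k' ->
  k * expR (1 / k) < k' * expR (1 / k').
Proof.
move=> k1 kk'; have k'0 : 0 < k' by lra.
have k0 : 0 < k by lra.
pose t := (k' - k) / k'.
have t0 : 0 < t by apply: divr_gt0; lra.
have kE : k = k' * (1 - t) by rewrite /t; field; lra.
have tE : 1 / k = 1 / k' + t / k by rewrite /t; field; lra.
have t1 : 1 - t < expR (- t).
  by have := @expR_gt1Dx _ (- t); rewrite oppr_eq0 gt_eqF// => /(_ isT).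
have tk : expR (t / k) <= expR t by rewrite ler_expR ler_pdivrMr//; nra.
have E1 : expR t * expR (- t) = 1 by rewrite -expRD subrr expR0.
have lt : (1 - t) * expR (t / k) < 1.
  have := expR_gt0 t; have := expR_gt0 (t / k).
  have [t1'|t1'] := leP 1 t; nra.
rewrite tE expRD; move: (expR_gt0 (1 / k')) lt; move: (expR (t / k)) => G.
move: (expR (1 / k')) => F F0 lt.
have -> : k * (F * G) = (k' * F) * ((1 - t) * G) by rewrite kE; ring.
by rewrite gtr_pMr// mulr_gt0.
Qed.

(** A strict inequality at k persists slightly to the right of k; the explicit
    step is half of what e^k' / k' <= e^k e^(k' - k) / k allows. *)
Lemma expR_div_room k x : 1 <= k -> x < - expR k / k ->
  exists2 k', k < k' & x < - expR k' / k'.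
Proof.
move=> k1 xk; have k0 : 0 < k by lra.
pose y := - x * k / expR k.
have y1 : 1 < y.
  by rewrite /y ltr_pdivlMr ?expR_gt0// mul1r -ltr_pdivrMr//; lra.
have l0 : 0 < - x.
  by have := divr_gt0 (expR_gt0 k) k0; lra.
pose t := ln y / 2.
have t0 : 0 < t by rewrite /t; have := ln_gt0 y1; lra.
have ty : expR t < y.
  rewrite -[ltRHS]lnK ?posrE; last lra.
  by rewrite ltr_expR /t; have := ln_gt0 y1; lra.
exists (k + t); first lra.
have ek : expR (k + t) < - x * k.
  by rewrite expRD mulrC -ltr_pdivlMr ?expR_gt0.
rewrite mulNr ltrNr ltr_pdivrMr; last lra.
nra.
Qed.

End inequalities.

(** * The lower orbit of the two-step map *)

Section lower.
Context (R : realType).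
Implicit Types (al be q x : R) (u : nat -> R).

Lemma ltr_powR_lt1 al q x : 0 < al < 1 -> q < x -> al `^ x < al `^ q.
Proof.
move=> /andP[a0 a1] qx; rewrite /powR gt_eqF// ltr_expR ltr_nM2r//.
by rewrite ln_lt0// a0.
Qed.

Lemma ler_powR_lt1 al q x : 0 < al < 1 -> q <= x -> al `^ x <= al `^ q.
Proof. by move=> /andP[a0 a1]; apply: ger_powR; rewrite a0 ltW. Qed.

Lemma two_step_le al be q x : 0 < al < 1 -> 0 < be < 1 -> q <= x ->
  two_step al be q <= two_step al be x.
Proof. by move=> al01 be01 qx; do 2! apply: ler_powR_lt1 => //. Qed.

Lemma two_step_lt1 al be q : 0 < al -> 0 < be < 1 -> two_step al be q < 1.
Proof.
move=> al0 be01; rewrite -[ltRHS](powRr0 be) ltr_powR_lt1//; exact: powR_gt0.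
Qed.

Definition lower al be k : R := iter k (two_step al be) 0.

Lemma lower_lt1 al be k : 0 < al -> 0 < be < 1 -> lower al be k < 1.
Proof. by move=> al0 be01; case: k => [|k] //=; exact: two_step_lt1. Qed.

Lemma lower_ge0 al be k : 0 <= lower al be k.
Proof. by case: k => [|k] //=; exact: powR_ge0. Qed.

Lemma lower_limit al be : 0 < al < 1 -> 0 < be < 1 ->
  exists l, [/\ 0 < l, two_step al be l = l, lower al be @ \oo --> l &
    (forall k, lower al be k <= al `^ lower al be k) -> l <= al `^ l].
Proof.
move=> al01 be01; have /andP[al0 _] := al01; have /andP[be0 _] := be01.
have nd : nondecreasing_seq (lower al be).
  apply/nondecreasing_seqP => n; elim: n => [|n IH]; first exact: powR_ge0.
  exact: two_step_le.
have cv : cvgn (lower al be).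
  apply: nondecreasing_is_cvgn => //; exists 1 => _ [n _ <-].
  exact/ltW/lower_lt1.
exists (limn (lower al be)).
have le k : lower al be k <= limn (lower al be).
  exact: nondecreasing_cvgn_le.
split=> //.
- by apply: lt_le_trans (le 1%N); exact: powR_gt0.
- have tE : two_step al be = fun q => expR (expR (q * ln al) * ln be).
    by apply/funext => q; rewrite /two_step /powR !gt_eqF.
  have ct : {for limn (lower al be), continuous (two_step al be)}.
    rewrite tE; apply: continuous_comp; last exact: continuous_expR.
    apply: continuousM; last exact: cst_continuous.
    apply: continuous_comp; last exact: continuous_expR.
    by apply: continuousM; [exact: cvg_id|exact: cst_continuous].
  have h1 : (fun n => two_step al be (lower al be n)) @ \oo -->
      two_step al be (limn (lower al be)).
    by apply: continuous_cvg; [exact: ct|exact: cv].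
  have h2 : (fun n => lower al be n.+1) @ \oo --> limn (lower al be).
    by have := cv; rewrite -(@cvg_shiftS _ (lower al be)).
  by apply: (cvg_unique _ h1 h2).
- move=> lt.
  have cp : (fun n => al `^ lower al be n) @ \oo --> al `^ limn (lower al be).
    rewrite /powR gt_eqF//; apply: continuous_cvg; first exact: continuous_expR.
    by apply: cvgM => //; exact: cvg_cst.
  apply: (ler_cvg_to cv cp); exact: nearW.
Qed.

(** Otherwise the limit l of the lower orbit would be a fixed point of the
    two-step map with l <= al^l. *)
Lemma lower_crossing al be : 0 < al < 1 -> 0 < be < 1 ->
  (forall q, 0 < q <= al `^ q -> q < two_step al be q) ->
  exists k, al `^ lower al be k <= lower al be k.
Proof.
move=> al01 be01 h; apply: contrapT => no.
have lt k : lower al be k <= al `^ lower al be k.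
  by rewrite leNgt; apply/negP => lt; apply: no; exists k; exact: ltW.
have [l [l0 lE _ /(_ lt) lal]] := lower_limit al01 be01.
by have := h l; rewrite l0 lal lE ltxx => /(_ isT).
Qed.

Lemma lower_cst_limit be : expR (- expR 1) <= be < 1 ->
  exists2 l, be `^ l = l & lower be be @ \oo --> l.
Proof.
move=> hbe; have /andP[be_e be1] := hbe.
have be01 : 0 < be < 1 by rewrite be1 (lt_le_trans _ be_e)// expR_gt0.
have [l [l0 lE cv lbe]] := lower_limit be01 be01; exists l => //.
have {}lbe : l <= be `^ l.
  apply: lbe; elim=> [|k IH]; first exact: powR_ge0.
  by rewrite /lower iterS; do 2!apply: ler_powR_lt1 => //.
apply/eqP; rewrite eq_le lbe andbT leNgt; apply/negP => bl.
by have := two_step_gt_euler hbe (q := l); rewrite l0 bl lE ltxx => /(_ isT).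
Qed.

End lower.

(** * Convergence from patterns with disjoint ranges *)

Section patterns.
Context (R : realType).
Implicit Types (al be q x : R) (u : nat -> R).

Lemma pullback_powR (x v : R) : 0 < x -> 0 < v -> ln x / ln v != 0 ->
  x = v `^ (ln x / ln v).
Proof.
move=> x0 v0; rewrite mulf_eq0 invr_eq0 negb_or => /andP[_ v1].
by rewrite /powR gt_eqF// divfK// lnK.
Qed.

(** The pattern of bases be, al, be, al, ... that makes a tower large: a large
    bottom base carrying a small exponent. *)
Definition high_low (al be : R) (j : nat) : set R :=
  if odd j then `]0, al]%classic else `[be, 1]%classic.

(** Two levels of the pattern map a value above q to a value above
    be^(al^q), starting from the trivial bound 0. *)
Lemma high_low_lower al be k u x : 0 < al < 1 -> 0 < be < 1 ->
  (forall i, (i < k.*2)%N -> high_low al be i (u i)) ->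
  (forall i, (i <= k.*2)%N -> 0 < pullback x u i < 1) ->
  lower al be k < x.
Proof.
move=> al01 be01; elim: k u x => [|k IH] u x hu hx.
  by have /andP[] := hx 0%N isT.
have /andP[x0 _] := hx 0%N isT.
have /andP[y0 _] : 0 < pullback x u 1 < 1 by apply: hx; rewrite doubleS.
have /andP[z0 _] : 0 < pullback x u 2 < 1 by apply: hx; rewrite doubleS.
have /andP[bu u01] : be <= u 0%N <= 1.
  by have := hu 0%N; rewrite doubleS /high_low /= in_itv; exact.
have /andP[u10 u1a] : 0 < u 1%N <= al.
  by have := hu 1%N; rewrite doubleS /high_low /= in_itv; exact.
have u00 : 0 < u 0%N by move: be01; lra.
have lz : lower al be k < pullback x u 2.
  apply: (IH (fun i => u (2 + i)%N)) => i ik.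
    have := hu i.+2; rewrite doubleS !ltnS ik => /(_ isT).
    by rewrite /high_low /= negbK.
  by rewrite -pullback_add; apply: hx; rewrite doubleS.
move: y0 z0 lz => /=; set y := ln x / ln (u 0%N) => y0 z0 lz.
have xE : x = u 0%N `^ y by apply: pullback_powR => //; rewrite gt_eqF.
have yE : y = u 1%N `^ (ln y / ln (u 1%N)).
  by apply: pullback_powR => //; rewrite gt_eqF.
have ya : y < al `^ lower al be k.
  rewrite yE; apply: le_lt_trans (ltr_powR_lt1 al01 lz).
  by rewrite ge0_ler_powR ?nnegrE ?(ltW z0) ?(ltW u10)//; move: al01; lra.
change (two_step al be (lower al be k) < x); rewrite xE.
apply: (@lt_le_trans _ _ (be `^ y)); first exact: ltr_powR_lt1.
by rewrite ge0_ler_powR ?nnegrE ?(ltW y0) ?(ltW u00)//; move: be01; lra.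
Qed.

(** Both c and its pullback y are crossed, hence at least the fixed point l by
    [high_low_lower]; as c = be^y <= be^l = l, equality holds. *)
Lemma crossed_cst be c : expR (- expR 1) <= be < 1 ->
  crossed (power_tower (fun=> be)) c -> c = lim (lower be be @ \oo).
Proof.
move=> hbe; have /andP[be_e be1] := hbe.
have be0 : 0 < be by rewrite (lt_le_trans _ be_e)// expR_gt0.
have be01 : 0 < be < 1 by rewrite be0.
have [l lE cv] := lower_cst_limit hbe; rewrite (cvg_lim _ cv)//.
have ge x : crossed (power_tower (fun=> be)) x -> l <= x.
  move=> cx; apply: (cvgr_to_le cv); apply: nearW => k; apply/ltW.
  apply: (@high_low_lower be be k (fun=> be)) => // i _.
    by rewrite /high_low; case: odd; rewrite /= in_itv/= lexx ?be0 ?ltW.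
  rewrite crossed_pullback_gt0//= crossed_pullback_lt1// => _.
  by rewrite be0 ltW.
move=> cc; apply/eqP; rewrite eq_le ge// andbT.
have [c0 _ cy] := @crossed_step _ (fun=> be) c (fun=> be0) cc.
have y0 := crossed_pullback_gt0 1 (fun=> be0) cc.
rewrite (pullback_powR c0 be0); last by rewrite gt_eqF.
rewrite -[leRHS]lE; apply: ler_powR_lt1 => //; exact: ge.
Qed.

Lemma power_tower_cst_cvg be : expR (- expR 1) <= be < 1 ->
  cvgn (power_tower (fun=> be)).
Proof.
move=> hbe; have /andP[be_e be1] := hbe.
have be0 : 0 < be by rewrite (lt_le_trans _ be_e)// expR_gt0.
have [M hM] := @power_tower_bounded _ (fun=> be) 0 (fun=> be0) (ltW be1).
apply: contrapT => /(@not_cvgn_crossed _ _ M)[|x [y [xy h]]].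
  by move=> n; rewrite hM andbT ltW// power_tower_gt0.
have h1 : x < (x + x + y) / 3 < y by lra.
have h2 : x < (x + y + y) / 3 < y by lra.
by have := crossed_cst hbe (h _ h1); rewrite -(crossed_cst hbe (h _ h2)); lra.
Qed.

End patterns.

Section convergence.
Context (R : realType) (d : measure_display) (T : measurableType d).
Context (P : probability T R) (A : nat -> {RV P >-> R}).
Context (A_iid : iid A) (A_gt0 : forall n w, 0 < A n w).

Lemma ae_cvg_tower :
  {ae P, forall w, exists k, A k w <= 1} ->
  (forall c, {ae P, forall w, ~ crossed (power_tower (A^~ w)) c}) ->
  {ae P, forall w, cvgn (power_tower (A^~ w))}.
Proof.
move=> bnd nc.
have : {ae P, forall w, forall n : nat,
    if (choice.unpickle n : option rat) is Some q then
      ~ crossed (power_tower (A^~ w)) (ratr q) else True}.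
  apply: ae_foralln => n.
  by case: choice.unpickle => [q|]; [exact: nc|exact: aeW].
apply: filterS2 bnd => w [k Ak] ncw.
have [M hM] := power_tower_bounded (fun n => A_gt0 n w) Ak.
apply: contrapT => /(@not_cvgn_crossed _ _ M)[|x [y [xy h]]].
  by move=> n; rewrite hM andbT ltW// power_tower_gt0.
have [q] := rat_in_itvoo xy; rewrite in_itv/= => /h.
by have := ncw (choice.pickle q); rewrite choice.pickleK.
Qed.

(** A base above 1 sends ]0, +oo[ above 1, a base below 1 sends it below 1. *)
Lemma ae_cvg_straddling :
  (0 < P (A 0%N @^-1` `]0%R, 1%R[))%E ->
  (0 < P (A 0%N @^-1` `]1%R, +oo[))%E ->
  {ae P, forall w, cvgn (power_tower (A^~ w))}.
Proof.
move=> p0 p1; apply: ae_cvg_tower.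
  apply: filterS (ae_hit A_iid (measurable_itv _) p0) => w [k].
  by rewrite /= in_itv/= => /andP[_ /ltW]; exists k.
move=> c.
have neg : P.-negligible
    [set w | forall k, `]0%R, +oo[%classic (pullback c (A^~ w) k)].
  apply: (@survival_negligible _ _ _ _ _ A_iid 1 (fun=> `]1, +oo[%classic)
    (fun=> `]0, 1[%classic) `]0, +oo[%classic `]1, +oo[%classic) => //.
    move=> u x /(_ 0%N isT) /=; rewrite in_itv/= andbT => u1 hx.
    have /= := hx 0%N isT; rewrite !in_itv/= !andbT => x0.
    have /= := hx 1%N isT; rewrite !in_itv/= !andbT => y0.
    have lu := ln_gt0 u1.
    rewrite ltNge; apply/negP => /ln_le0.
    by move: y0; rewrite pmulr_lgt0 ?invr_gt0//; lra.
  move=> u x /(_ 0%N isT) /=; rewrite in_itv/= => u1 hx.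
  have /= := hx 0%N isT; rewrite !in_itv/= !andbT => x0.
  have /= := hx 1%N isT; rewrite !in_itv/= !andbT => y0.
  have lu := ln_lt0 u1.
  move=> /ln_gt0; move: y0; rewrite nmulr_lgt0 ?invr_lt0//; lra.
apply: negligibleS neg => w /contrapT cw k.
by rewrite /= in_itv/= andbT; apply: crossed_pullback_gt0.
Qed.

(** After 2k bases of the pattern the tower is above l_k = lower al be k; after
    a base at most al followed by this pattern it is below al^(l_k) <= l_k. *)
Lemma ae_cvg_lower (al be : R) (k : nat) : 0 < al < 1 -> 0 < be < 1 ->
  al `^ lower al be k <= lower al be k ->
  (P (A 0%N @^-1` `]1%R, +oo[) = 0)%E ->
  (0 < P (A 0%N @^-1` `]0%R, al]))%E ->
  (0 < P (A 0%N @^-1` `[be, 1%R]))%E ->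
  {ae P, forall w, cvgn (power_tower (A^~ w))}.
Proof.
move=> al01 be01 hk p1 pa pb.
have le1 : {ae P, forall w, forall n, `]-oo, 1%R]%classic (A n w)}.
  by apply: (ae_all A_iid) => //; rewrite setCitvl.
apply: ae_cvg_tower.
  by apply: filterS le1 => w /(_ 0%N); rewrite /= in_itv/=; exists 0%N.
move=> c.
have neg : P.-negligible
    [set w | forall k, `]0%R, 1%R[%classic (pullback c (A^~ w) k)].
  pose B2 j := if j is i.+1 then high_low al be i else `]0, al]%classic.
  apply: (@survival_negligible _ _ _ _ _ A_iid k.*2.+1 (high_low al be)
    B2 `]0, 1[%classic `](lower al be k), +oo[%classic) => //.
  - by move=> j; rewrite /high_low; case: odd.
  - by case=> [|j] //=; rewrite /high_low; case: odd.
  - by move=> j; rewrite /high_low; case: odd.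
  - by case=> [|j] //=; rewrite /high_low; case: odd.
  - move=> u x hu hx; rewrite /= in_itv/= andbT.
    apply: high_low_lower (al01) (be01) _ _ => i ik.
      by apply: hu; exact: ltnW.
    by have := hx i (leqW ik); rewrite /= in_itv.
  - move=> u x hu hx; rewrite /= in_itv/= andbT; apply/negP; rewrite -leNgt.
    have /= := hu 0%N isT; rewrite in_itv/= => /andP[u0 ua].
    have /= := hx 0%N isT; rewrite in_itv/= => /andP[x0 _].
    have ly : lower al be k < ln x / ln (u 0%N).
      apply: (@high_low_lower _ al be k (shift1 u)) => // i ik.
        exact: (hu i.+1).
      by rewrite -pullbackS; have := hx i.+1 ik; rewrite [X in X -> _]/= in_itv.
    have l0 := lower_ge0 al be k.
    rewrite (pullback_powR x0 u0); last by rewrite gt_eqF// (le_lt_trans l0).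
    apply: le_trans hk; apply: le_trans (ltW (ltr_powR_lt1 al01 ly)).
    by rewrite ge0_ler_powR ?nnegrE ?(ltW u0)//; move: al01; lra.
have bad : P.-negligible [set w | ~ forall n, `]-oo, 1%R]%classic (A n w)].
  exact: le1.
apply: negligibleS (negligibleU neg bad) => w /contrapT cw.
have [h|h] := pselect (forall n, `]-oo, 1%R]%classic (A n w)); last by right.
left=> j; rewrite /= in_itv/=; apply/andP; split.
  exact: crossed_pullback_gt0.
apply: crossed_pullback_lt1 => // n; rewrite A_gt0.
by have := h n; rewrite /= in_itv.
Qed.

Lemma ae_cvg_cst (be : R) : expR (- expR 1) <= be < 1 ->
  (P (A 0%N @^-1` `]-oo, be[) = 0)%E ->
  (P (A 0%N @^-1` `]be, +oo[) = 0)%E ->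
  {ae P, forall w, cvgn (power_tower (A^~ w))}.
Proof.
move=> hbe p1 p2.
have h1 : {ae P, forall w, forall n, `[be, +oo[%classic (A n w)}.
  by apply: (ae_all A_iid) => //; rewrite setCitvr.
have h2 : {ae P, forall w, forall n, `]-oo, be]%classic (A n w)}.
  by apply: (ae_all A_iid) => //; rewrite setCitvl.
apply: filterS2 h1 h2 => w h1 h2.
rewrite (_ : A^~ w = fun=> be); first exact: power_tower_cst_cvg.
apply/funext => n; apply/eqP; rewrite eq_le.
by have := h1 n; have := h2 n; rewrite /= !in_itv/= andbT => -> ->.
Qed.

Lemma ae_cvg_e :
  (P (A 0%N @^-1` `]-oo, 1%R[) = 0)%E ->
  (P (A 0%N @^-1` `](expR (1 / expR 1))%R, +oo[) = 0)%E ->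
  {ae P, forall w, cvgn (power_tower (A^~ w))}.
Proof.
move=> p1 p2.
have h1 : {ae P, forall w, forall n, `[1, +oo[%classic (A n w)}.
  by apply: (ae_all A_iid) => //; rewrite setCitvr.
have h2 : {ae P, forall w, forall n, `]-oo, expR (1 / expR 1)]%classic (A n w)}.
  by apply: (ae_all A_iid) => //; rewrite setCitvl.
apply: filterS2 h1 h2 => w h1 h2.
have h n : 1 <= A n w <= expR (1 / expR 1).
  by have := h1 n; have := h2 n; rewrite /= !in_itv/= andbT => -> ->.
apply: (@power_tower_ge1_cvg _ _ (expR 1)) => n.
  by have /andP[] := h n.
exact: power_tower_le_e.
Qed.

End convergence.

(** * Bounded towers of bases at least 1 *)

Section height.
Context (R : realType).
Implicit Types (b : R) (u : nat -> R) (c m n : nat).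

Lemma exp_towerS m : exp_tower R m.+1 = expR (exp_tower R m).
Proof. by []. Qed.

Lemma exp_tower_gt m : m%:R < exp_tower R m.
Proof.
elim: m => [|m IH]; first exact: ltr01.
rewrite exp_towerS -natr1; have := expR_ge1Dx (exp_tower R m); lra.
Qed.

Lemma exp_tower_gt0 m : 0 < exp_tower R m.
Proof. by apply: le_lt_trans (exp_tower_gt m). Qed.

Lemma exp_tower_le : {homo exp_tower R : m n / (m <= n)%N >-> m <= n}.
Proof.
apply/nondecreasing_seqP => m; rewrite exp_towerS.
have := expR_ge1Dx (exp_tower R m); lra.
Qed.

Lemma log_star_exp_tower m : 0 <= log_star (exp_tower R m) <= m%:R.
Proof.
have lb : lbound [set n%:R | n in
    [set n : nat | exp_tower R m <= exp_tower R n]] (0 : R).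
  by move=> _ [n _ <-].
apply/andP; split.
  by apply: lb_le_inf => //; exists m%:R; exists m => /=.
by apply: ge_inf; [exists 0|exists m => /=].
Qed.

Definition threshold m : R := 1 + (exp_tower R m)^-1.

(** The number of bases read since the last reset, when the tower is read from
    its top (the base of index N - 1) down to its bottom (the base of index 0);
    the offset c leaves room for the value e after a reset. *)
Fixpoint height c u N : nat :=
  if N is n.+1 then
    let h := height c (shift1 u) n in
    if u 0%N <= threshold (h + c) then 0 else h.+1
  else 0.

(** The factor b absorbs the change of base: from b X <= E one gets
    b b^X = exp((X + 1) ln b) <= exp(b X) <= exp(E), as 2 ln b <= b and X >= 1.
    A reset gives b u^X <= b (1 + 1/E)^E <= b e. *)
Lemma height_bound b c u N : (forall k, 1 <= u k <= b) ->
  b * expR 1 <= exp_tower R c ->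
  b * power_tower u N <= exp_tower R (height c u N + c).
Proof.
move=> u1b bc; have b1 : 1 <= b by have /andP[] := u1b 0%N; lra.
elim: N u u1b => [|N IH] u u1b.
  rewrite /= mulr1 add0n; apply: le_trans bc.
  by have := expR_ge1Dx (1 : R); nra.
have {}IH := IH (shift1 u) (fun k => u1b k.+1).
have X1 : 1 <= power_tower (shift1 u) N.
  by apply: power_tower_ge1 => k; have /andP[] := u1b k.+1.
have /andP[u01 u0b] := u1b 0%N.
rewrite power_towerS /=.
move: IH X1; set h := height _ _ _; set X := power_tower _ _ => IH X1.
have E0 := exp_tower_gt0 (h + c).
rewrite /powR gt_eqF; last lra.
case: ifP => [ut|_].
  rewrite add0n; apply: le_trans bc; rewrite ler_pM2l; last lra.
  rewrite ler_expR.
  have : ln (u 0%N) <= (exp_tower R (h + c))^-1.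
    rewrite -[leRHS]expRK ler_ln ?posrE ?expR_gt0//; last lra.
    by apply: le_trans ut _; exact: expR_ge1Dx.
  rewrite -div1r ler_pdivlMr// => lE.
  apply: le_trans lE; rewrite mulrC ler_wpM2l ?ln_ge0//.
  by apply: le_trans IH; nra.
rewrite addSn exp_towerS -[b in b * _](@lnK R) ?posrE; last lra.
rewrite -expRD ler_expR; apply: le_trans IH.
(* exp(b/2) >= (1 + b/4)^2 >= b *)
have lnb : 2 * ln b <= b.
  suff : ln b <= b / 2 by lra.
  rewrite -[leRHS]expRK ler_ln ?posrE ?expR_gt0//; last lra.
  rewrite (_ : b / 2 = b / 4 + b / 4); last by field.
  rewrite expRD; have := expR_ge1Dx (b / 4).
  by have := sqr_ge0 (1 - b / 4); nra.
have lub : ln (u 0%N) <= ln b by rewrite ler_ln ?posrE; lra.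
have lb0 : 0 <= ln b by apply: ln_ge0.
nra.
Qed.

(** The last reset precedes the reading of the bottom bases of indices
    j - 1, ..., 0, which exceeded the thresholds of heights 0, ..., j - 1. *)
Lemma height_run c u N i : (i < height c u N)%N ->
  threshold ((height c u N).-1 - i + c) < u i.
Proof.
elim: N u i => [//|N IH] u i /=; set h := height _ _ _.
case: ifP => [//|/negbT]; rewrite -ltNge => ut /=.
case: i => [|i]; first by rewrite subn0.
rewrite ltnS => ih; have := IH (shift1 u) i ih.
by rewrite -/h subnS predn_sub.
Qed.

Lemma power_tower_cvg_heights b c n u : (forall k, 1 <= u k <= b) ->
  b * expR 1 <= exp_tower R c ->
  (forall j, (n <= j)%N -> exists2 i, (i < j)%N &
    u i <= threshold (j.-1 - i + c)) ->
  cvgn (power_tower u).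
Proof.
move=> u1b bc hj; apply: (@power_tower_ge1_cvg _ _ (exp_tower R (n + c))).
  by move=> k; have /andP[] := u1b k.
move=> N; have b1 : 1 <= b by have /andP[] := u1b 0%N; lra.
have T1 : 1 <= power_tower u N.
  by apply: power_tower_ge1 => k; have /andP[] := u1b k.
apply: (@le_trans _ _ (b * power_tower u N)); first by nra.
apply: le_trans (height_bound N u1b bc) _.
apply: exp_tower_le; rewrite leq_add2r leqNgt; apply/negP => /ltnW /hj[i ih].
by rewrite leNgt height_run.
Qed.

(** Kummer's summation test with weights j + c - 1: the hypothesis on g makes
    del s_j <= (j + c - 1) s_j - (j + c) s_(j+1), and the sum telescopes. *)
Lemma kummer_bound (s g : nat -> R) c (del : R) : (0 < c)%N -> 0 < del ->
  s 0%N = 1 -> (forall j, 0 <= s j) ->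
  (forall j, s j.+1 = g j * s j) ->
  (forall j, (j + c)%:R * g j <= (j + c)%:R - 1 - del) ->
  forall n, \sum_(0 <= j < n) s j <= c%:R / del.
Proof.
move=> c0 d0 s0 sp sS hg n; rewrite ler_pdivlMr//.
suff : (\sum_(0 <= j < n) s j) * del + ((n + c)%:R - 1) * s n <= c%:R - 1.
  have : 0 <= ((n + c)%:R - 1) * s n.
    by rewrite mulr_ge0// subr_ge0 ler1n addn_gt0 c0 orbT.
  lra.
elim: n => [|n IH]; first by rewrite big_geq// s0 mul0r add0r add0n mulr1.
rewrite big_nat_recr//= sS addSn -natr1.
have := hg n; have := sp n; move: IH; set S := \sum_(_ <= _ < _) _; nra.
Qed.

End height.

Section bounded_towers.
Context (R : realType) (d : measure_display) (T : measurableType d).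
Context (P : probability T R) (A : nat -> {RV P >-> R}).
Context (A_iid : iid A).

(** Each event E j concerns the first j bases only, so that the bound on the
    heights holds for towers of all sizes at once. *)
Lemma ae_cvg_log_star (b del : R) (c0 : nat) :
  (P (A 0%N @^-1` `]-oo, 1%R[) = 0)%E ->
  (P (A 0%N @^-1` `]b, +oo[) = 0)%E ->
  0 < del ->
  (forall m, (c0 <= m)%N ->
    ((1 + del)%:E <=
     P (A 0%N @^-1` `]-oo, (threshold R m)]) * m%:R%:E)%E) ->
  {ae P, forall w, cvgn (power_tower (A^~ w))}.
Proof.
move=> p1 pb d0 hq.
pose c := (maxn c0 (Num.truncn (b * expR 1)).+1).+1.
have cc0 : (c0 <= c)%N by rewrite ltnW// ltnS leq_maxl.
have bc : b * expR 1 <= exp_tower R c.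
  apply/ltW/(lt_trans _ (exp_tower_gt R c)).
  apply: lt_le_trans (truncnS_gt _) _.
  by rewrite ler_nat ltnW// ltnS leq_maxr.
have h1 : {ae P, forall w, forall n, `[1, +oo[%classic (A n w)}.
  by apply: (ae_all A_iid) => //; rewrite setCitvr.
have h2 : {ae P, forall w, forall n, `]-oo, b]%classic (A n w)}.
  by apply: (ae_all A_iid) => //; rewrite setCitvl.
pose B j i : set R := `](threshold R (j.-1 - i + c)), +oo[%classic.
have mB j i : measurable (B j i) by exact: measurable_itv.
pose E j := block A 0 j (B j).
have mE j : measurable (E j) by exact: measurable_block.
pose g j : R := fine (P (A 0%N @^-1` `](threshold R (j + c)), +oo[)).
have gE j : P (A 0%N @^-1` `](threshold R (j + c)), +oo[) = (g j)%:E.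
  by rewrite fineK// fin_num_measure//; exact: (measurable_preimage A 0).
pose s j : R := \prod_(0 <= i < j) g i.
have sE j : P (E j) = (s j)%:E.
  rewrite /E (prob_block A_iid)// /s; elim: j => [|j IH].
    by rewrite !big_geq.
  rewrite [in RHS]big_nat_recr//= mulrC EFinM -IH -gE big_nat_recl// /B subn0.
  by congr (_ * _)%E; apply: eq_bigr => i _; rewrite /= subnS predn_sub.
have sum n : \sum_(0 <= j < n) s j <= c%:R / del.
  apply: (@kummer_bound _ s g) => //.
  - by rewrite /s big_geq.
  - by move=> j; rewrite -lee_fin -sE.
  - by move=> j; rewrite /s big_nat_recr//= mulrC.
  - move=> j; have := hq (j + c)%N.
    rewrite (leq_trans cc0 (leq_addl _ _)) => /(_ isT).
    have -> : A 0%N @^-1` `]-oo, (threshold R (j + c))] =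
        ~` (A 0%N @^-1` `](threshold R (j + c)), +oo[).
      by rewrite preimage_setC setCitvr.
    rewrite probability_setC; last exact: (measurable_preimage A 0).
    by rewrite gE -EFinB -EFinM lee_fin; nra.
have null : P (lim_sup_set E) = 0%E.
  apply: lim_sup_set_cvg0 => //.
  apply: (@le_lt_trans _ _ (c%:R / del)%:E); last exact: ltry.
  apply: lime_le; first exact: is_cvg_nneseries.
  apply: nearW => n.
  rewrite (eq_bigr (fun j => (s j)%:E)) => [|j _]; last exact: sE.
  by rewrite sumEFin lee_fin.
have h3 : {ae P, forall w, ~ lim_sup_set E w}.
  exists (lim_sup_set E); split => //.
    apply: bigcap_measurable => // n _.
    by apply: bigcup_measurable => j _; exact: mE.
  by move=> w /= /contrapT.
apply: filterS3 h1 h2 h3 => w h1 h2 h3.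
have /existsNP[n hn] : ~ (forall n, (\bigcup_(j >= n) E j) w).
  by move=> h; apply: h3 => n _; exact: h.
apply: (@power_tower_cvg_heights _ b c n) => // [k|j nj].
  by have := h1 k; have := h2 k; rewrite /= !in_itv/= andbT => -> ->.
apply: contrapT => hj; apply: hn; exists j => // i /= ij.
by rewrite /B /= in_itv/= andbT ltNge; apply/negP => ut; apply: hj; exists i.
Qed.

End bounded_towers.

(** * Support of the law, the Lambert function and the iterated logarithm *)

Section support.
Context (R : realType) (d : measure_display) (T : measurableType d).
Context (P : probability T R) (X : {RV P >-> R}).

Lemma measurable_preim (B : set R) :
  measurable B -> measurable (X @^-1` B).
Proof.
by move=> mB; rewrite -[X in measurable X]setTI; exact: measurable_funP.
Qed.

Lemma inf_support_lt (al : R) : (inf_support X < al%:E)%E ->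
  (0 < P (X @^-1` `]-oo, al[))%E.
Proof.
move=> /ereal_inf_lt[_ [x Sx <-]]; rewrite lte_fin => xal.
apply: Sx; first exact: interval_open.
by rewrite /= in_itv.
Qed.

Lemma sup_support_gt (be : R) : (be%:E < sup_support X)%E ->
  (0 < P (X @^-1` `]be, +oo[))%E.
Proof.
move=> /ereal_sup_gt[_ [x Sx <-]]; rewrite lte_fin => xbe.
apply: Sx; first exact: interval_open.
by rewrite /= in_itv/= xbe.
Qed.

(** Every point of U has a null neighbourhood, hence lies in a null interval
    with rational endpoints; there are countably many of these. *)
Lemma open_support0 (U : set R) :
  open U -> (forall x, U x -> ~ law_support X x) -> (P (X @^-1` U) = 0)%E.
Proof.
move=> oU US; apply/negligibleP.
  by apply: measurable_preim; exact: open_measurable.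
pose I (r : rat * rat) : set R := `]ratr r.1, ratr r.2[%classic.
pose F n := if (choice.unpickle n : option (rat * rat)) is Some r then
  if P (X @^-1` I r) == 0%E then X @^-1` I r else set0 else set0.
apply: (@negligibleS _ _ _ P (\bigcup_n F n)).
  move=> w Uw; have /existsNP[V /existsNP[oV /existsNP[VX /negP]]] := US _ Uw.
  rewrite -leNgt => V0.
  have /nbhs_ballP[e /= e0 eV] : nbhs (X w) V by exact: open_nbhs_nbhs.
  have [p /[!in_itv]/= /andP[p1 p2]] : exists p, ratr p \in `]X w - e, X w[.
    by apply: rat_in_itvoo; lra.
  have [q /[!in_itv]/= /andP[q1 q2]] : exists q, ratr q \in `]X w, X w + e[.
    by apply: rat_in_itvoo; lra.
  exists (choice.pickle (p, q)); [exact: Logic.I|rewrite /F choice.pickleK].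
  have IV : I (p, q) `<=` V.
    move=> y; rewrite /I /= in_itv/= => /andP[py yq]; apply: eV.
    by rewrite /ball /= ltr_norml; lra.
  rewrite ifT; first by rewrite /I /= in_itv/= p2 q1.
  rewrite eq_le measure_ge0 andbT; apply: le_trans V0.
  rewrite le_measure ?inE//.
  - by apply: measurable_preim; exact: measurable_itv.
  - by apply: measurable_preim; exact: open_measurable.
  - by move=> y; exact: IV.
apply: negligible_bigcup => n; rewrite /F.
case: choice.unpickle => [r|]; last exact: negligible_set0.
case: eqP => [r0|_]; last exact: negligible_set0.
by apply/negligibleP => //; apply: measurable_preim; exact: measurable_itv.
Qed.

Lemma inf_support_ge (al : R) : (al%:E <= inf_support X)%E ->
  (P (X @^-1` `]-oo, al[) = 0)%E.
Proof.
move=> ale; apply: open_support0; first exact: interval_open.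
move=> x; rewrite /= in_itv/= => xal Sx.
have : (inf_support X <= x%:E)%E by apply: ereal_inf_lbound; exists x.
by move=> /(le_trans ale); rewrite lee_fin leNgt xal.
Qed.

Lemma sup_support_le (be : R) : (sup_support X <= be%:E)%E ->
  (P (X @^-1` `]be, +oo[) = 0)%E.
Proof.
move=> lebe; apply: open_support0; first exact: interval_open.
move=> x; rewrite /= in_itv/= andbT => xbe Sx.
have : (x%:E <= sup_support X)%E by apply: ereal_sup_ubound; exists x.
by move=> /le_trans/(_ lebe); rewrite lee_fin leNgt xbe.
Qed.

End support.

Lemma lambertW_spec (R : realType) (x : R) : - expR (- 1) <= x < 0 ->
  -1 <= lambertW x < 0 /\ lambertW x * expR (lambertW x) = x.
Proof.
move=> /andP[x1 x0].
have [w] : exists2 w, w \in `[(-1 : R), 0] & w * expR w = x.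
  apply: IVT; first lra.
    apply: continuous_subspaceT => w.
    by apply: continuousM; [exact: cvg_id|exact: continuous_expR].
  rewrite mul0r mulN1r ge_min le_max x1/= orbC ltW//.
rewrite in_itv/= => /andP[w1 w0] wx.
have [l1 lx] : -1 <= lambertW x /\ lambertW x * expR (lambertW x) = x.
  by apply: (@getPex _ [set w : R | -1 <= w /\ w * expR w = x]); exists w.
split=> //; rewrite l1 ltNge; apply/negP => l0.
by have := expR_gt0 (lambertW x); nra.
Qed.

(** Evaluation at the thresholds t = 1 + 1/E, for E the exponential tower of
    height m: they tend to 1 from above, and the iterated logarithm of
    1 / (t - 1) = E is at most m. *)
Lemma limf_log_star (R : realType) (F : R -> \bar R) :
  (forall t, (0 <= F t)%E) ->
  (1 < limf_einf (fun t : R => F t * (log_star (1 / (t - 1)))%:E) 1^'+)%E ->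
  exists2 del : R, 0 < del & exists c0, forall m, (c0 <= m)%N ->
    ((1 + del)%:E <= F (threshold R m) * m%:R%:E)%E.
Proof.
move=> F0; rewrite limf_einfE => /ereal_sup_gt[_ [V V1 <-]].
set x := ereal_inf _ => x1.
have [del d0 dx] : exists2 del : R, 0 < del & ((1 + del)%:E <= x)%E.
  case: x x1 => [r| |//]; last by exists 1 => //; rewrite leey.
  by rewrite lte_fin => r1; exists (r - 1); rewrite ?lee_fin; lra.
exists del => //; have [e /= e0 eV] := V1.
exists (Num.truncn e^-1).+1 => m em.
have E0 := exp_tower_gt0 R m.
have tE : threshold R m - 1 = (exp_tower R m)^-1 by rewrite /threshold; lra.
have Vt : V (threshold R m).
  apply: eV; rewrite /= /threshold; last by rewrite ltrDl invr_gt0.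
  rewrite opprD addrA subrr sub0r normrN gtr0_norm ?invr_gt0//.
  rewrite invf_plt ?posrE//; apply: lt_trans (exp_tower_gt R m).
  by apply: lt_le_trans (truncnS_gt _) _; rewrite ler_nat.
apply: (le_trans dx); apply: (@le_trans _ _
    (F (threshold R m) * (log_star (1 / (threshold R m - 1)))%:E)%E).
  by apply: ereal_inf_lbound; exists (threshold R m).
rewrite tE div1r invrK; apply: lee_wpmul2l => //.
by rewrite lee_fin; have /andP[] := log_star_exp_tower R m.
Qed.

(** * The regimes of the infimum and supremum of the support *)

Section regimes.
Context (R : realType) (d : measure_display) (T : measurableType d).
Context (P : probability T R) (A : nat -> {RV P >-> R}).
Context (A_iid : iid A) (A_gt0 : forall n w, 0 < A n w).

Lemma measurable_preimage0 (B : set R) :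
  measurable B -> measurable (A 0%N @^-1` B).
Proof. exact: (measurable_preimage A 0). Qed.

Lemma prob_low (al : R) : (inf_support (A 0%N) < al%:E)%E ->
  (0 < P (A 0%N @^-1` `]0%R, al]))%E.
Proof.
move=> /inf_support_lt /lt_le_trans; apply.
rewrite le_measure ?inE//; [exact: measurable_preimage0..|].
by move=> w; rewrite /= !in_itv/= A_gt0 => /ltW.
Qed.

Lemma prob_high (be : R) : (be%:E < sup_support (A 0%N))%E ->
  (P (A 0%N @^-1` `]1%R, +oo[) = 0)%E ->
  (0 < P (A 0%N @^-1` `[be, 1%R]))%E.
Proof.
move=> /sup_support_gt pb p1; apply: lt_le_trans pb _.
rewrite -[leRHS]adde0 -p1.
apply: (@le_trans _ _ (P (A 0%N @^-1` `[be, 1%R] `|` A 0%N @^-1` `]1%R, +oo[))).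
  rewrite le_measure ?inE//.
  - exact: measurable_preimage0.
  - by apply: measurableU; exact: measurable_preimage0.
  move=> w; rewrite /= !in_itv/= !andbT => bw.
  by have [w1|w1] := leP (A 0%N w) 1; [left; rewrite ltW|right].
by apply: measureU2; exact: measurable_preimage0.
Qed.

Lemma sup_support_gt0 : (0 < sup_support (A 0%N))%E.
Proof.
rewrite ltNge; apply/negP => /sup_support_le.
rewrite (_ : A 0%N @^-1` _ = setT); last first.
  by apply/seteqP; split => w //= _; rewrite in_itv/= A_gt0.
by rewrite probability_setT => /eqP; rewrite onee_eq0.
Qed.

Lemma inf_support_ge0 : (0 <= inf_support (A 0%N))%E.
Proof.
rewrite leNgt; apply/negP => /inf_support_lt.
rewrite (_ : A 0%N @^-1` _ = set0) ?measure0 ?ltxx//.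
by apply/seteqP; split => w //=; rewrite in_itv/= ltNge ltW.
Qed.

(** If no base exceeds 1, then al^be -> al < 1 as be -> 1, so l_1 = be
    already satisfies al^(l_1) <= l_1. *)
Lemma ae_cvg_above :
  (inf_support (A 0%N) < 1)%E -> (1 <= sup_support (A 0%N))%E ->
  {ae P, forall w, cvgn (power_tower (A^~ w))}.
Proof.
move=> a1 b1.
have [p1|p1] := eqVneq (P (A 0%N @^-1` `]1%R, +oo[)) 0%E; last first.
  apply: ae_cvg_straddling => //; last by rewrite lt0e p1/=.
  have := inf_support_lt a1; congr (_ < P _)%E; apply/seteqP.
  by split=> w; rewrite /= !in_itv/= A_gt0.
have [al al01 aal] : exists2 al : R,
    0 < al < 1 & (inf_support (A 0%N) < al%:E)%E.
  have /ereal_inf_lt[_ [x Sx <-]] := a1; rewrite lte_fin => x1.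
  exists ((Num.max x 0 + 1) / 2); first by rewrite /Num.max; case: ifP; lra.
  apply: (@le_lt_trans _ _ x%:E); first by apply: ereal_inf_lbound; exists x.
  by rewrite lte_fin /Num.max; case: ifP; lra.
have s1 : al `^ (1 / 2) < 1.
  by rewrite -[ltRHS](powRr0 al) ltr_powR_lt1//; lra.
(* al^b <= al^(1/2) <= b *)
pose b := Num.max (1 / 2) (al `^ (1 / 2)).
have b01 : 0 < b < 1 by rewrite /b lt_max gt_max s1 andbT; lra.
apply: (@ae_cvg_lower _ _ _ _ _ A_iid A_gt0 al b 1) => //.
- rewrite /lower /= /two_step powRr0 powRr1; last lra.
  apply: (@le_trans _ _ (al `^ (1 / 2))); last by rewrite le_max lexx orbT.
  by apply: ler_powR_lt1 => //; rewrite le_max lexx.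
- exact: prob_low.
- apply: prob_high => //; apply: lt_le_trans b1; rewrite lte_fin; lra.
Qed.

(** Again k = 1 is enough, with al = be^(1/be): then al^be = be = l_1. *)
Lemma ae_cvg_inf0 : inf_support (A 0%N) = 0%E ->
  {ae P, forall w, cvgn (power_tower (A^~ w))}.
Proof.
move=> a0; have [p1|p1] := eqVneq (P (A 0%N @^-1` `]1%R, +oo[)) 0%E; last first.
  apply: ae_cvg_straddling => //; last by rewrite lt0e p1/=.
  have a1 : (inf_support (A 0%N) < 1)%E by rewrite a0 lte01.
  have := inf_support_lt a1; congr (_ < P _)%E; apply/seteqP.
  by split=> w; rewrite /= !in_itv/= A_gt0.
have [b b01 bb] : exists2 b : R, 0 < b < 1 & (b%:E < sup_support (A 0%N))%E.
  have /ereal_sup_gt[_ [x Sx <-]] := sup_support_gt0; rewrite lte_fin => x1.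
  exists (Num.min x 1 / 2); first by rewrite /Num.min; case: ifP; lra.
  apply: (@lt_le_trans _ _ x%:E); last by apply: ereal_sup_ubound; exists x.
  by rewrite lte_fin /Num.min; case: ifP; lra.
have /andP[b0 b1] := b01.
have al0 : 0 < b `^ (1 / b) by exact: powR_gt0.
apply: (@ae_cvg_lower _ _ _ _ _ A_iid A_gt0 (b `^ (1 / b)) b 1) => //.
- rewrite al0 -[ltRHS](powRr0 b) ltr_powR_lt1//; exact: divr_gt0.
- rewrite /lower /= /two_step powRr0 (powRr1 (ltW b0)) -powRrM divfK ?gt_eqF//.
  by rewrite (powRr1 (ltW b0)).
- by apply: prob_low; rewrite a0 lte_fin.
- exact: prob_high.
Qed.

Lemma ae_cvg_crossing (al be : R) : 0 < al < 1 -> 0 < be < 1 ->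
  (inf_support (A 0%N) < al%:E)%E -> (be%:E < sup_support (A 0%N) <= 1)%E ->
  (forall q, 0 < q <= al `^ q -> q < two_step al be q) ->
  {ae P, forall w, cvgn (power_tower (A^~ w))}.
Proof.
move=> al01 be01 aal /andP[beb b1] h.
have [k hk] := lower_crossing al01 be01 h.
have p1 := sup_support_le b1.
apply: (ae_cvg_lower A_iid A_gt0 al01 be01 hk p1).
- exact: prob_low.
- exact: prob_high.
Qed.

(** The strict inequality leaves room to increase k, hence to choose be < b,
    as well as al > a. Fixed points q > 1/e of the two-step map do not matter
    here, since al < e^-e gives al^q < 1/e < q for them. *)
Lemma ae_cvg_lambert (a b k : R) :
  inf_support (A 0%N) = a%:E -> sup_support (A 0%N) = b%:E ->
  0 < a -> 1 <= k -> b = expR (- k * expR (1 / k)) -> ln a < - expR k / k ->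
  {ae P, forall w, cvgn (power_tower (A^~ w))}.
Proof.
move=> aE bE a0 k1 bk ak.
have k0 : 0 < k by lra.
have aM : a < expR (- expR k / k) by rewrite -[ltLHS]lnK ?posrE// ltr_expR.
pose al := (a + expR (- expR k / k)) / 2.
have aal : a < al by rewrite /al; lra.
have al0 : 0 < al by lra.
have lal : ln al < - expR k / k.
  by rewrite -[ltRHS]expRK ltr_ln ?posrE ?expR_gt0//; rewrite /al; lra.
have ek : expR 1 <= expR k / k.
  rewrite ler_pdivlMr// -[in leRHS](subrK 1 k) expRD mulrC.
  by rewrite ler_pM2r ?expR_gt0//; have := expR_ge1Dx (k - 1); lra.
have lale : ln al < - expR 1 by lra.
have al1 : al < 1.
  rewrite -(@lnK _ al) ?posrE// -expR0 ltr_expR.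
  by have := expR_gt0 (1 : R); lra.
have al01 : 0 < al < 1 by rewrite al0.
have [k' kk' lal'] := expR_div_room k1 lal.
have k'1 : 1 <= k' by apply: ltW; exact: le_lt_trans kk'.
pose be := expR (- k' * expR (1 / k')).
have be0 : 0 < be by exact: expR_gt0.
have be1 : be < 1.
  rewrite -[ltRHS]expR0 ltr_expR mulNr oppr_lt0 mulr_gt0 ?expR_gt0//.
  exact: lt_le_trans ltr01 _.
have beb : be < b by rewrite bk ltr_expR !mulNr ltrN2; exact: mulr_expRV_lt.
have b1 : b <= 1.
  by rewrite bk -expR0 ler_expR mulNr oppr_le0 mulr_ge0 ?expR_ge0//; lra.
apply: (@ae_cvg_crossing al be) => //.
- by rewrite be0.
- by rewrite aE lte_fin.
- by rewrite bE lte_fin lee_fin beb.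
- move=> q /andP[q0 qal]; apply: (two_step_gt_lambert k'1) => //.
  rewrite q0 leNgt; apply/negP => q1.
  have : al `^ q < al `^ expR (-1) by exact: ltr_powR_lt1.
  have : al `^ expR (- 1) < expR (- 1).
    rewrite /powR gt_eqF// ltr_expR -(@ltr_pM2l _ (expR 1)) ?expR_gt0//.
    by rewrite mulrA -expRD subrr expR0 mul1r mulrN1.
  lra.
Qed.

(** For al < be and q <= al^q one has q < be^q and
    be^(be^q) < be^(al^q), so [two_step_gt_euler] applies. *)
Lemma ae_cvg_euler (a b : R) :
  inf_support (A 0%N) = a%:E -> sup_support (A 0%N) = b%:E ->
  0 < a < b -> expR (- expR 1) < b < 1 ->
  {ae P, forall w, cvgn (power_tower (A^~ w))}.
Proof.
move=> aE bE /andP[a0 ab] /andP[eb b1].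
pose be := (Num.max a (expR (- expR 1)) + b) / 2.
have eM : expR (- expR 1) <= Num.max a (expR (- expR 1)).
  by rewrite le_max lexx orbT.
have aM : a <= Num.max a (expR (- expR 1)) by rewrite le_max lexx.
have Mb : Num.max a (expR (- expR 1)) < b by rewrite gt_max ab.
have abe : a < be by rewrite /be; lra.
have beb : be < b by rewrite /be; lra.
have ebe : expR (- expR 1) <= be by rewrite /be; lra.
pose al := (a + be) / 2.
have al01 : 0 < al < 1 by rewrite /al; lra.
have be01 : 0 < be < 1 by lra.
have albe : al < be by rewrite /al; lra.
apply: (@ae_cvg_crossing al be) => //.
- by rewrite aE lte_fin /al; lra.
- by rewrite bE lte_fin lee_fin beb ltW.
- move=> q /andP[q0 qal].
  have alq : al `^ q < be `^ q.
    by apply: gt0_ltr_powR; rewrite ?nnegrE//; lra.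
  apply: (@lt_trans _ _ (two_step be be q)); last exact: ltr_powR_lt1.
  apply: two_step_gt_euler; first by rewrite ebe; lra.
  by rewrite q0 (le_lt_trans qal).
Qed.

(** The parameter is k = - 1 / w, for w in [-1, 0[ the value of the Lambert
    function at 1 / ln b. *)
Lemma lambertW_parameter (b : R) : 0 < b < expR (- expR 1) ->
  exists k, [/\ 1 <= k, b = expR (- k * expR (1 / k)) &
    lambertW (1 / ln b) * expR (- (1 / lambertW (1 / ln b))) = - expR k / k].
Proof.
move=> /andP[b0 be].
have lb : ln b < - expR 1 by rewrite -[ltRHS]expRK ltr_ln ?posrE ?expR_gt0.
have e0 := expR_gt0 (1 : R).
have x_range : - expR (-1) <= 1 / ln b < 0.
  apply/andP; split; last by rewrite div1r invr_lt0; lra.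
  rewrite expRN div1r -invrN lef_nV2 ?negrE; lra.
have := lambertW_spec x_range.
move: (lambertW _) => w [/andP[w1 w0] wE].
exists (- w^-1); split.
- by rewrite -invrN invf_ge1; lra.
- rewrite -[LHS](@lnK _ b) ?posrE//; congr expR.
  rewrite opprK div1r invrN invrK.
  have : ln b = 1 / (1 / ln b) by field; lra.
  by rewrite -wE div1r invfM -expRN.
- by rewrite div1r invrN invrK mulrNN mulrC.
Qed.

End regimes.

Theorem corollary1p3 (R : realType) (d : measure_display) (T : measurableType d)
    (P : probability T R) (A : nat -> {RV P >-> R}) (a b : \bar R)
    (A_gt0 : forall n w, 0 < A n w)
    (A_iid : iid A)
    (aE : a = inf_support (A 0%N))
    (bE : b = sup_support (A 0%N)) :
  (a = 0)%E \/
  ((expR (- expR 1))%:E <= b <= (expR (1 / expR 1))%:E)%E \/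
  (a < 1 <= b)%E \/
  [/\ (b < (expR (- expR 1))%:E)%E
    & (a < (expR (lambertW (1 / ln (fine b))
                  * expR (- (1 / lambertW (1 / ln (fine b))))))%:E)%E] \/
  [/\ (a = 1)%E, (b < +oo)%E
    & (1 < limf_einf (fun t : R => P [set w | (A 0%N w <= t)%R]
                                   * (log_star (1 / (t - 1)))%:E) 1^'+)%E] ->
  {ae P, forall w, cvgn (fun n => power_tower (fun k => A k w) n)}.
Proof.
have b0 : (0 < b)%E by rewrite bE; exact: (sup_support_gt0 A_gt0).
have a0 : (0 <= a)%E by rewrite aE; exact: (inf_support_ge0 A_gt0).
have [aa _|an0] := eqVneq a 0%E.
  by apply: (ae_cvg_inf0 A_iid A_gt0); rewrite -aE.
have {a0 an0} a0 : (0 < a)%E by rewrite lt0e an0.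
have above : (a < 1 <= b)%E -> {ae P, forall w, cvgn (power_tower (A^~ w))}.
  by move=> /andP[a1 b1]; apply: (ae_cvg_above A_iid A_gt0); rewrite -?aE -?bE.
move=> [/eqP|[/andP[be b_e]|[|[[be ab]|[a1 boo lim]]]]] //.
- by rewrite gt_eqF.
- have [b1|b1] := leP 1%E b.
    have [a1|a1] := ltP a 1%E; first by apply: above; rewrite a1.
    by apply: (ae_cvg_e A_iid) => //; [apply: inf_support_ge; rewrite -aE|
      apply: sup_support_le; rewrite -bE].
  case: b bE b0 above be b_e b1 => [b| |//] bE; rewrite ?lee_fin ?lte_fin//.
  move=> b0 _ be _ b1.
  have [ba|ab] := leP b%:E a.
    apply: (@ae_cvg_cst _ _ _ _ _ A_iid b) => //; first by rewrite be.
      by apply: inf_support_ge; rewrite -aE.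
    by apply: sup_support_le; rewrite -bE.
  case: a aE a0 ab => [a| |//] aE; rewrite ?lte_fin// => a0 ab.
  have [eb|be'] := ltP (expR (- expR 1)) b.
    apply: (@ae_cvg_euler _ _ _ _ _ A_iid A_gt0 a b) => //.
      by rewrite a0.
    by rewrite eb.
  have bb : b = expR (- expR 1) by apply/eqP; rewrite eq_le be'.
  apply: (@ae_cvg_lambert _ _ _ _ _ A_iid A_gt0 a b 1) => //.
    by rewrite divr1 mulN1r.
  by rewrite divr1 -[ltRHS]expRK ltr_ln ?posrE ?expR_gt0// -bb.
- case: b bE b0 above be ab => [b| |//] bE; rewrite ?lte_fin// => b0 _ be.
  have [k [k1 bk ->]] : exists k, [/\ 1 <= k, b = expR (- k * expR (1 / k)) &
    lambertW (1 / ln b) * expR (- (1 / lambertW (1 / ln b))) = - expR k / k].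
    by apply: lambertW_parameter; rewrite b0.
  case: a aE a0 => [a| |//] aE; rewrite ?lte_fin// => a0 ak.
  apply: (@ae_cvg_lambert _ _ _ _ _ A_iid A_gt0 a b k) => //.
  by rewrite -[ltRHS]expRK ltr_ln ?posrE ?expR_gt0.
- have [del d0 [c0 hc]] := limf_log_star (fun t => measure_ge0 P _) lim.
  have [r br] : exists r : R, (b <= r%:E)%E.
    case: b boo {bE b0 above} => [r _|//|_]; first by exists r.
    by exists 0; rewrite leNye.
  apply: (@ae_cvg_log_star _ _ _ _ _ A_iid r del c0) => //.
    by apply: inf_support_ge; rewrite -aE a1.
  by apply: sup_support_le; rewrite -bE.
Qed.
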